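(* For every positive integer $s$, $$\dim k\otimes_{G(4)}\mathscr{P}_A((P_4)_{2^{s+2}+2^{s+1}-3}^{*})=\begin{cases}0 & \text{if } s=2,\\ 1 & \text{if } s\neq 2.\end{cases}$$
   Context: $k=\mathbb{Z}/2$, $A$ is the mod 2 Steenrod algebra and $G(4)=GL_4(k)$. $P_4=k[x_1,\dots,x_4]$, $\deg x_i=1$, with the usual $A$-action and $G(4)$ acting by linear substitution; $(P_4)_n$ its degree-$n$ part. $(P_4)^*$ is the dual divided power algebra on $a_1^{(1)},\dots,a_4^{(1)}$ (dual to $x_1,\dots,x_4$) with the dual right $A$-action; $\mathscr{P}_A((P_4)_n^* )$ is the subspace of $(P_4)_n^*$ annihilated by all $Sq^i$, $i>0$, and $k\otimes_{G(4)}\mathscr{P}_A((P_4)_n^* )$ denotes its space of $G(4)$-coinvariants. *)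

(* Defs.v *)
From HB Require Import structures.
From mathcomp Require Import all_boot all_order all_algebra.
From mathcomp Require Import mpoly.
Set Implicit Arguments. Unset Strict Implicit. Unset Printing Implicit Defensive.
Import GRing.Theory.
Local Open Scope ring_scope.

Notation P4 := {mpoly 'F_2[4]}.

Definition Mon (n : nat) : finType :=
  {e : {ffun 'I_4 -> 'I_n.+1} | (\sum_(i < 4) val (e i))%N == n}.

Definition mono (n : nat) (m : Mon n) : 'X_{1..4} :=
  [multinom val (val m i) | i < 4].

(* (P_4)_n^dual : linear functionals on (P_4)_n, given by their values on the
   monomial basis (i.e. coordinates in the dual basis a^(e)). *)
Definition Dual (n : nat) := {ffun Mon n -> ('F_2)^o}.

Definition pairing (n : nat) (f : Dual n) (p : P4) : 'F_2 :=
  \sum_(m : Mon n) f m * p@_(mono m).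

(* Steenrod square Sq^i on P_4 (Cartan formula + Sq^j x^r = C(r,j) x^(r+j)):
   Sq^i(x^e) = sum_{t_1+..+t_4 = i} prod_j C(e_j,t_j) x^(e+t). *)
Definition Sq (i : nat) (p : P4) : P4 :=
  \sum_(m <- msupp p) p@_m *:
     \sum_(t : Mon i) (\prod_(j < 4) 'C(m j, val (val t j)))%:R *: 'X_[(m + mono t)%MM].

Definition GL4 : seq 'M['F_2]_4 := [seq g <- enum 'M['F_2]_4 | g \in unitmx].

Definition act (g : 'M['F_2]_4) (p : P4) : P4 :=
  p \mPo [tuple \sum_(i < 4) g i j *: 'X_i | j < 4].

Definition dact (n : nat) (g : 'M['F_2]_4) (f : Dual n) : Dual n :=
  [ffun m => pairing f (act g 'X_[mono m])].

(* f is A-annihilated: f Sq^i = 0 in (P_4)_{n-i}^dual for all i > 0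
   (tested on the monomial basis of (P_4)_{n-i}; for i > n it is vacuous). *)
Definition primb (n : nat) (f : Dual n) : bool :=
  [forall i : 'I_n.+1, (0 < val i)%N ==>
     [forall m : Mon (n - val i), pairing f (Sq (val i) 'X_[mono m]) == 0]].

Definition prim_list (n : nat) : seq (Dual n) := [seq f <- enum (Dual n) | primb f].

Definition PA (n : nat) : {vspace Dual n} := <<prim_list n>>%VS.

Definition coinv_rel (n : nat) : {vspace Dual n} :=
  <<[seq dact g f - f | f <- prim_list n, g <- GL4]>>%VS.

(* dim k (x)_{G(4)} P_A((P_4)_n^dual) = dim P_A - dim (augmentation submodule) *)
Definition coinv_dim (n : nat) : nat := (\dim (PA n) - \dim (coinv_rel n))%N.

(* Main.v *)
Require Import Defs.
From HB Require Import structures.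
From mathcomp Require Import all_boot all_order all_algebra.
From mathcomp Require Import mpoly.
From mathcomp Require Import ring zify.
Set Implicit Arguments. Unset Strict Implicit. Unset Printing Implicit Defensive.
Import GRing.Theory.
Local Open Scope ring_scope.

(* A functional on (P_4)_n is A-annihilated iff it is invariant under the total
   square St. In the degrees n_s (n_0 = 3, n_{s+1} = 2 n_s + 3) an annihilated
   functional c kills all monomials x_i p^2, so it only sees the monomials with
   exactly three odd exponents and is given by its four slices
   c_i(p) = c(x_j x_k x_l p^2), annihilated functionals in degree n_{s-1}; the
   only further condition is sum_i c_i(x_i y) = 0. This condition makes iterated
   slices symmetric, c_ij = c_ji, and gives c_iil = c_lli. Hence the s-fold slices
   of c, which have degree 3, depend only on the set of indices used, and c amounts
   to a family of degree 3 functionals F_U, U a nonempty set of at most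
   min(s, 4) indices, subject to linear relations. The transvection
   x_a -> x_a + x_b sends F_U to F_U o t, plus F_{U - b + a} o t if b is in U, so
   the whole coinvariant computation depends on min(s, 5) only, and takes place in
   F_2^320. *)

Notation mon := 'X_{1..4}.
Notation fnl := (mon -> 'F_2).

Lemma F2_cases (c : 'F_2) : c = 0 \/ c = 1.
Proof. by case: c => -[|[|//]] i; [left|right]; apply/val_inj. Qed.

Lemma addF2K (c : 'F_2) : c + c = 0.
Proof. by case: (F2_cases c) => ->; apply/val_inj. Qed.

Lemma addF2_eq0 (c d : 'F_2) : c + d = 0 -> c = d.
Proof. by move=> cd; rewrite -[c]addr0 -(addF2K d) addrA cd add0r. Qed.

Lemma addP4K (p : P4) : p + p = 0.
Proof. by rewrite -mulr2n -scaler_nat (_ : 2%:R = 0 :> 'F_2) ?scale0r //; apply/val_inj. Qed.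

Lemma sqrP4D (p q : P4) : (p + q) ^+ 2 = p ^+ 2 + q ^+ 2.
Proof. by rewrite sqrrD mulr2n addP4K addr0. Qed.

Lemma monomial_ind (P : P4 -> Prop) :
  P 0 -> (forall p q, P p -> P q -> P (p + q)) -> (forall m, P 'X_[m]) ->
  forall p, P p.
Proof.
move=> P0 PD PX p; rewrite [p]mpolyE; apply: (big_ind P) => // m _.
by case: (F2_cases p@_m) => ->; rewrite ?scale0r ?scale1r.
Qed.

Definition ev (c : fnl) (p : P4) : 'F_2 := \sum_(m <- msupp p) p@_m * c m.

Lemma evwE c p k : (msize p <= k)%N ->
  ev c p = \sum_(m : 'X_{1..4 < k}) p@_m * c m.
Proof.
pose I : subFinType _ := 'X_{1..4 < k}.
move=> lt_pk; rewrite /ev (ssrcomplements.big_mksub I) //=; first last.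
  by move=> x /msize_mdeg_lt /leq_trans/(_ lt_pk) ->.
  by rewrite msupp_uniq.
by rewrite big_rmcond //= => i /memN_msupp_eq0 ->; rewrite mul0r.
Qed.

Lemma ev_is_linear c : scalar (ev c).
Proof.
move=> a p q; pose k := maxn (msize (a *: p + q)) (maxn (msize p) (msize q)).
rewrite !(@evwE c _ k) /k ?leq_max ?leqnn ?orbT // mulr_sumr -big_split /=.
by apply: eq_bigr => m _; rewrite linearP /= mulrDl mulrA.
Qed.

HB.instance Definition _ c :=
  GRing.isLinear.Build 'F_2 P4 'F_2 _ (ev c) (ev_is_linear c).

Lemma evX c m : ev c 'X_[m] = c m.
Proof. by rewrite /ev msuppX big_seq1 mcoeffX eqxx mul1r. Qed.

Lemma eq_ev c d : c =1 d -> ev c =1 ev d.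
Proof. by move=> cd p; apply: eq_bigr => m _; rewrite cd. Qed.

Definition homdeg n (c : fnl) := forall m, mdeg m <> n -> c m = 0.

(** * The total Steenrod square *)

Definition St (p : P4) : P4 := p \mPo [tuple 'X_j + 'X_j ^+ 2 | j < 4].

HB.instance Definition _ := GRing.RMorphism.copy St (comp_mpoly _).

(* [Sq i p] is a homogeneous component of [St p], and a functional on one degree
   sees a single component: invariance under [St] says that all [Sq i] with
   [i > 0] are annihilated (see [primbP]). *)
Definition prim (c : fnl) := forall p, ev c (St p) = ev c p.

Lemma StXU i : St 'X_i = 'X_i + 'X_i ^+ 2.
Proof. by rewrite /St comp_mpolyXU -tnth_nth tnth_mktuple. Qed.

Lemma StX m N : (mdeg m <= N)%N ->
  St 'X_[m] = \sum_(t : {ffun 'I_4 -> 'I_N.+1})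
    (\prod_(j < 4) 'C(m j, t j))%:R *: 'X_[(m + [multinom val (t i) | i < 4])%MM].
Proof.
move=> mN; rewrite /St comp_mpolyX.
under eq_bigr => i _.
  rewrite tnth_mktuple -[X in X + _]mulr1 expr2 -mulrDr exprMn [1 + _]addrC exprD1n.
  have -> : \sum_(k < (m i).+1) 'X_i ^+ k *+ 'C(m i, k)
          = \sum_(k < N.+1) ('X_i : P4) ^+ k *+ 'C(m i, k).
    rewrite (big_ord_widen N.+1 (fun k => ('X_i : P4) ^+ k *+ 'C(m i, k))); last first.
      by rewrite ltnS (leq_trans _ mN) // mdegE (bigD1 i) //= leq_addr.
    rewrite big_mkcond; apply: eq_bigr => k _.
    by case: ltnP => // ?; rewrite bin_small.
  over.
rewrite big_split /= -mpolyXE_id bigA_distr_bigA mulr_sumr.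
apply: eq_bigr => t _; rewrite mpolyXD scalerAr; congr (_ * _).
rewrite prodrMn scaler_nat mpolyXE_id; congr (_ *+ _).
by apply: eq_bigr => i _; rewrite mnmE.
Qed.

Lemma mdeg_mono n (u : Mon n) : mdeg (mono u) = n.
Proof.
by rewrite mdegE -[RHS](eqP (valP u)); apply: eq_bigr => i _; rewrite mnmE.
Qed.

Lemma mono_inj n : injective (@mono n).
Proof.
move=> u v /mnmP uv; apply/val_inj/ffunP => i; apply: val_inj.
by have := uv i; rewrite !mnmE.
Qed.

Lemma mono_surj n m : mdeg m = n -> exists u : Mon n, mono u = m.
Proof.
move=> mn; have mi i : (m i < n.+1)%N.
  by rewrite ltnS -mn mdegE (bigD1 i) //= leq_addr.
have su : (\sum_(i < 4) val ([ffun i => Ordinal (mi i)] i))%N == n.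
  by rewrite -[X in _ == X]mn mdegE; apply/eqP/eq_bigr => i _; rewrite ffunE.
by exists (exist _ [ffun i => Ordinal (mi i)] su); apply/mnmP => i; rewrite mnmE ffunE.
Qed.

Lemma sum_Mon n N (V : nmodType) (G : mon -> V) : (n <= N)%N ->
  \sum_(t : {ffun 'I_4 -> 'I_N.+1} | (\sum_(i < 4) val (t i))%N == n)
     G [multinom val (t i) | i < 4] = \sum_(u : Mon n) G (mono u).
Proof.
move=> nN; have nN1 : (n.+1 <= N.+1)%N by [].
pose h (u : Mon n) := [ffun i => widen_ord nN1 (val u i)].
have h_inj : injective h.
  move=> u v /ffunP uv; apply/val_inj/ffunP => i; apply: val_inj.
  by have /(congr1 val) := uv i; rewrite !ffunE.
transitivity (\sum_(t in h @: setT) G [multinom val (t i) | i < 4]).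
  apply: eq_bigl => t; apply/idP/imsetP => [/eqP tn | [u _ ->]].
    have [u um] : exists u : Mon n, mono u = [multinom val (t i) | i < 4].
      by apply: mono_surj; rewrite -[RHS]tn mdegE; apply: eq_bigr => i _; rewrite mnmE.
    exists u => //; apply/ffunP => i; apply: val_inj.
    by move/mnmP: um => /(_ i); rewrite !mnmE !ffunE.
  by rewrite -[X in _ == X](eqP (valP u)); apply/eqP/eq_bigr => i _; rewrite ffunE.
rewrite big_imset /=; last by move=> ? ? _ _; apply: h_inj.
apply: eq_big => [u|u _]; first by rewrite inE.
by congr G; apply/mnmP => i; rewrite !mnmE ffunE.
Qed.

Lemma mdeg_ffun N (t : {ffun 'I_4 -> 'I_N.+1}) :
  mdeg [multinom val (t i) | i < 4] = (\sum_(i < 4) val (t i))%N.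
Proof. by rewrite mdegE; apply: eq_bigr => i _; rewrite mnmE. Qed.

Lemma ev_Sq n c m i : homdeg n c -> (mdeg m + i)%N = n ->
  ev c (Sq i 'X_[m]) = ev c (St 'X_[m]).
Proof.
move=> cn min; have mn : (mdeg m <= n)%N by rewrite -min leq_addr.
have i_n : (i <= n)%N by rewrite -min leq_addl.
rewrite /Sq msuppX big_seq1 mcoeffX eqxx scale1r (StX mn) !raddf_sum /=.
rewrite [RHS](bigID (fun t : {ffun 'I_4 -> 'I_n.+1} => (\sum_(i < 4) val (t i))%N == i)) /=.
rewrite [X in _ = _ + X]big1 => [|t /eqP ti]; last first.
  rewrite linearZ /= evX cn ?mulr0 // mdegD mdeg_ffun => e.
  by apply: ti; apply/(@addnI (mdeg m)); rewrite e min.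
rewrite addr0.
transitivity (\sum_(u : Mon i) ev c ((\prod_(j < 4) 'C(m j, mono u j))%:R *: 'X_[m + mono u])).
  apply: eq_bigr => t _; congr (ev c (_%:R *: _)).
  by apply: eq_bigr => j _; rewrite mnmE.
rewrite -(sum_Mon (fun u => ev c ((\prod_(j < 4) 'C(m j, u j))%:R *: 'X_[m + u])) i_n).
apply: eq_bigr => t _; congr (ev c (_%:R *: _)).
by apply: eq_bigr => j _; rewrite mnmE.
Qed.

Lemma ev_St_low n c m : homdeg n c -> (n <= mdeg m)%N -> ev c (St 'X_[m]) = c m.
Proof.
move=> cn mn; rewrite (StX (leqnn _)) raddf_sum (bigD1 [ffun=> ord0]) //=.
have -> : [multinom val ([ffun=> ord0 : 'I_(mdeg m).+1] i) | i < 4] = 0%MM.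
  by apply/mnmP => i; rewrite mnmE ffunE mnm0E.
rewrite big1 ?addr0 => [|i _]; last by rewrite ffunE bin0.
rewrite scale1r evX addm0 big1 ?addr0 // => t t0.
rewrite linearZ /= evX cn ?mulr0 // mdegD mdeg_ffun => mtn.
case/eqP: t0; apply/ffunP => i; rewrite ffunE; apply: val_inj => /=.
by move: mn; rewrite -mtn (bigD1 i) //=; lia.
Qed.

Lemma ev_St_high c m : homdeg (mdeg m).*2 c -> ev c (St 'X_[m]) = c (m + m)%MM.
Proof.
move=> cn; rewrite (StX (leqnn _)) raddf_sum.
have mi i : (m i < (mdeg m).+1)%N by rewrite ltnS mdegE (bigD1 i) //= leq_addr.
rewrite (bigD1 [ffun i => Ordinal (mi i)]) //=.
have -> : [multinom val ([ffun i => Ordinal (mi i)] i) | i < 4] = m.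
  by apply/mnmP => i; rewrite mnmE ffunE.
rewrite big1 ?addr0 => [|i _]; last by rewrite ffunE binn.
rewrite scale1r evX big1 ?addr0 // => t tm; rewrite linearZ /= evX.
have [tn | tn] := eqVneq (mdeg (m + [multinom val (t i) | i < 4])) (mdeg m).*2; last first.
  by rewrite cn ?mulr0 //; apply/eqP.
have [[i mti] | tlem] : (exists i, m i < t i)%N \/ (forall i, t i <= m i)%N.
- case: (boolP [forall i, t i <= m i]%N) => [/forallP|/forallPn[i]]; first by right.
  by rewrite -ltnNge; left; exists i.
- by rewrite (bigD1 i) //= bin_small // mul0n mul0r.
case/eqP: tm; apply/ffunP => i; rewrite ffunE; apply: val_inj => /=.
have : (\sum_i (m i - t i) = 0)%N.
  rewrite sumnB // -mdegE; apply/eqP; rewrite subn_eq0.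
  by move: tn; rewrite mdegD mdeg_ffun -addnn => /addnI ->.
by move/eqP; rewrite sum_nat_eq0 => /forallP/(_ i)/=; rewrite subn_eq0 => ?; apply/eqP; rewrite eqn_leq tlem.
Qed.

(** * Slices of a functional *)

Definition shift (u : mon) (c : fnl) : fnl := fun m => c (u + m)%MM.

Lemma ev_shift u c p : ev (shift u c) p = ev c ('X_[u] * p).
Proof.
elim/monomial_ind: p => [|p q IHp IHq|m]; first by rewrite mulr0 !raddf0.
  by rewrite mulrDr !raddfD /= IHp IHq.
by rewrite -mpolyXD !evX.
Qed.

Lemma ev_eq0 c p : (forall m, c m = 0) -> ev c p = 0.
Proof. by move=> c0; rewrite /ev big1 // => m _; rewrite c0 mulr0. Qed.

Definition XS (A : {set 'I_4}) : mon := [multinom (i \in A : nat) | i < 4].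

Lemma mdeg_XS A : mdeg (XS A) = #|A|.
Proof.
rewrite mdegE -sum1_card [RHS]big_mkcond; apply: eq_bigr => i _.
by rewrite mnmE; case: (i \in A).
Qed.

Lemma XS1 i : XS [set i] = U_(i)%MM.
Proof. by apply/mnmP => j; rewrite mnmE mnm1E inE eq_sym. Qed.

Lemma mpolyXS A : 'X_[XS A] = \prod_(i in A) 'X_i :> P4.
Proof.
rewrite mpolyXE_id [RHS]big_mkcond; apply: eq_bigr => i _.
by rewrite mnmE; case: (i \in A).
Qed.

Definition oddset (m : mon) : {set 'I_4} := [set i | odd (m i)].
Definition halfm (m : mon) : mon := [multinom (m i)./2 | i < 4].

Lemma mon_split m : (XS (oddset m) + (halfm m + halfm m))%MM = m.
Proof.
by apply/mnmP => i; rewrite !mnmDE !mnmE inE addnn odd_double_half.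
Qed.

Lemma oddset_split A m : oddset (XS A + (m + m)) = A.
Proof.
apply/setP => i; rewrite inE !mnmDE mnmE addnn oddD odd_double addbF.
by case: (i \in A).
Qed.

Lemma halfm_split A m : halfm (XS A + (m + m)) = m.
Proof.
by apply/mnmP => i; rewrite mnmE !mnmDE mnmE addnn half_bit_double.
Qed.

Definition sl (A : {set 'I_4}) (c : fnl) : fnl := fun m => c (XS A + (m + m))%MM.

Lemma ev_sl A c p : ev (sl A c) p = ev c ('X_[XS A] * p ^+ 2).
Proof.
elim/monomial_ind: p => [|p q IHp IHq|m].
- by rewrite expr0n mulr0 !raddf0.
- by rewrite sqrP4D mulrDr !raddfD /= IHp IHq.
- by rewrite expr2 -!mpolyXD !evX.
Qed.

Notation slice i := (sl (~: [set i])).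

Lemma cardsC1_4 (i : 'I_4) : #|~: [set i]| = 3%N.
Proof. by rewrite cardsC1 card_ord. Qed.

Lemma card4 (A : {set 'I_4}) : (#|A| <= 4)%N.
Proof. by have := max_card A; rewrite card_ord. Qed.

Lemma card3_setC1 (A : {set 'I_4}) : #|A| = 3%N -> exists i, A = ~: [set i].
Proof.
move=> A3; have := cardsC A; rewrite A3 card_ord => /(@addnI 3 _ 1)/eqP/cards1P[i Ai].
by exists i; rewrite -Ai setCK.
Qed.

Definition weight3 (c : fnl) := forall (A : {set 'I_4}) m, #|A| <> 3%N -> c (XS A + (m + m))%MM = 0.

Lemma homdeg_slice n i c : homdeg (n.*2 + 3)%N c -> homdeg n (slice i c).
Proof.
move=> cn m mn; apply: cn; rewrite !mdegD mdeg_XS cardsC1_4 addnn addnC => /addIn.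
by move/double_inj.
Qed.

Lemma St_XS A : St 'X_[XS A] =
  \sum_(B : {set 'I_4} | B \subset A) 'X_[XS (A :\: B)] * 'X_[XS B] ^+ 2.
Proof.
rewrite mpolyXS rmorph_prod /= big_mkcond /=.
transitivity (\prod_(i < 4) ((if i \in A then 'X_i ^+ 2 else 0)
                           + (if i \in A then 'X_i else 1)) : P4).
  by apply: eq_bigr => i _; case: ifP => _; rewrite ?StXU 1?addrC ?addr0.
rewrite bigA_distr [RHS]big_mkcond; apply: eq_bigr => B _.
case: ifPn => [BA | /subsetPn[i iB iA]]; last first.
  by rewrite (bigD1 i) //= iB (negbTE iA) mul0r.
rewrite !mpolyXS -prodrXl (bigID (mem B)) /= mulrC; congr (_ * _).
  rewrite big_mkcond [RHS]big_mkcond; apply: eq_bigr => i _.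
  by rewrite !inE; case: (i \in B); case: (i \in A).
by apply: eq_bigr => i iB; rewrite iB (subsetP BA).
Qed.

Lemma ev_St_XS c A (p : P4) : ev c (St ('X_[XS A] * p ^+ 2)) =
  \sum_(B : {set 'I_4} | B \subset A) ev (sl (A :\: B) c) ('X_[XS B] * St p).
Proof.
rewrite rmorphM rmorphXn /= St_XS mulr_suml (raddf_sum (ev c)).
by apply: eq_bigr => B _; rewrite ev_sl exprMn -mulrA.
Qed.

Section Weight3.
Variables (c : fnl) (c3 : weight3 c).

Lemma sl_weight3 (A : {set 'I_4}) p : #|A| <> 3%N -> ev (sl A c) p = 0.
Proof. by move=> A3; apply: ev_eq0 => m; apply: c3. Qed.

Lemma ev_St_slice i (p : P4) :
  ev c (St ('X_[XS (~: [set i])] * p ^+ 2)) = ev (slice i c) (St p).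
Proof.
rewrite ev_St_XS (bigD1 set0) ?sub0set //= setD0.
rewrite big1 ?addr0 => [|B /andP[BA B0]].
  rewrite (_ : XS set0 = 0%MM) ?mpolyX0 ?mul1r //.
  by apply/mnmP => j; rewrite mnmE inE mnm0E.
apply: sl_weight3 => /eqP; rewrite cardsD (setIidPr BA) cardsC1_4.
by move: B0; rewrite -card_gt0; lia.
Qed.

Lemma ev_St_full (p : P4) :
  ev c (St ('X_[XS setT] * p ^+ 2)) = \sum_(i < 4) ev (slice i c) ('X_i * St p).
Proof.
rewrite ev_St_XS (bigID (fun B : {set 'I_4} => #|B| == 1%N)) /= [X in _ + X]big1 ?addr0.
  transitivity (\sum_(B in [set [set i] | i : 'I_4])
                  ev (sl (setT :\: B) c) ('X_[XS B] * St p)).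
    apply: eq_bigl => B; rewrite subsetT; apply/cards1P/imsetP => [[i ->]|[i _ ->]]; by exists i.
  rewrite big_imset /=; last by move=> i j _ _; apply: set1_inj.
  by apply: eq_big => [i|i _]; rewrite ?inE // setTD XS1.
move=> B /andP[_ B1]; apply: sl_weight3 => /eqP; rewrite setTD cardsCs setCK card_ord.
by move: B1 (card4 B); move: #|B| => k; lia.
Qed.

Lemma ev_St_small (A : {set 'I_4}) (p : P4) : (#|A| < 3)%N -> ev c (St ('X_[XS A] * p ^+ 2)) = 0.
Proof.
move=> A3; rewrite ev_St_XS big1 // => B _; apply: sl_weight3.
by move: (subset_leq_card (subsetDl A B)); lia.
Qed.

End Weight3.

Definition contr (d : 'I_4 -> fnl) : fnl := fun m => \sum_(i < 4) d i (U_(i) + m)%MM.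

Lemma ev_contr d p : ev (contr d) p = \sum_(i < 4) ev (d i) ('X_i * p).
Proof.
elim/monomial_ind: p => [|p q IHp IHq|m].
- by rewrite raddf0 big1 // => i _; rewrite mulr0 raddf0.
- rewrite raddfD /= IHp IHq -big_split; apply: eq_bigr => i _.
  by rewrite mulrDr raddfD.
- by rewrite evX; apply: eq_bigr => i _; rewrite -mpolyXD evX.
Qed.

Lemma homdeg_contr n d : (forall i, homdeg n (d i)) -> homdeg n.-1 (contr d).
Proof.
move=> dn m mn; rewrite /contr big1 // => i _; apply: dn; rewrite mdegD mdeg1 add1n.
by move=> e; apply: mn; rewrite -e.
Qed.

Lemma primX c : (forall m, ev c (St 'X_[m]) = c m) -> prim c.
Proof.
move=> cX; elim/monomial_ind => [|p q IHp IHq|m]; first by rewrite !raddf0.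
  by rewrite !raddfD /= IHp IHq.
by rewrite evX.
Qed.

Lemma prim_slices n c : homdeg (n.*2 + 3)%N c -> weight3 c ->
  prim c <-> (forall i, prim (slice i c)) /\ (forall m, contr (fun i => slice i c) m = 0).
Proof.
move=> cn c3; have dn i : homdeg n (slice i c) by apply: homdeg_slice.
split=> [cP | [dP d0]].
  split=> [i p | m]; first by rewrite -ev_St_slice // cP ev_sl.
  have [mn | /eqP mn] := eqVneq (mdeg m) n.-1; last by rewrite (homdeg_contr dn).
  rewrite -(ev_St_low (homdeg_contr dn)) ?mn // ev_contr -(ev_St_full c3) cP -ev_sl.
  by rewrite evX /sl c3 // cardsT card_ord.
apply: primX => m; rewrite -[in RHS](mon_split m) -[in LHS](mon_split m).
set A := oddset m; set h := halfm m.
rewrite mpolyXD mpolyXD -expr2.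
have [A3 | A3] := eqVneq #|A| 3%N.
  have [i ->] := card3_setC1 A3.
  by rewrite ev_St_slice // dP evX.
rewrite [RHS]c3; last exact/eqP.
have [AT | AT] := eqVneq #|A| 4%N; last first.
  by rewrite ev_St_small //; move: A3 AT (card4 A); lia.
have -> : A = setT by apply/eqP; rewrite eqEcard subsetT cardsT card_ord AT.
by rewrite ev_St_full // -ev_contr; apply: ev_eq0.
Qed.

(* With [chi = sum_j x^(2^j)] (the conjugate total square of [x]) one has
   [St (chi * p) = x * St p]; so [x * p ^ 2], the top part of [x * St p], is hit
   unless its degree matches that of some [x^(2^j) * p]. *)
Lemma prim_kill1 D c i m : homdeg D.*2.+1 c -> prim c -> (forall j, D.+1 <> 2 ^ j)%N ->
  c (U_(i) + (m + m))%MM = 0.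
Proof.
move=> cn cP D2.
have [mD | mD] := eqVneq (mdeg m) D; last first.
  apply: cn; rewrite !mdegD mdeg1 addnn add1n => -[]/double_inj/eqP; exact/negP.
have chi J : St (\sum_(j < J) 'X_i ^+ (2 ^ j)) = 'X_i + 'X_i ^+ (2 ^ J).
  elim: J => [|J IH]; first by rewrite big_ord0 raddf0 expn0 expr1 addP4K.
  rewrite big_ord_recr /= raddfD /= IH rmorphXn /= StXU.
  have -> : ('X_i + 'X_i ^+ 2 : P4) ^+ (2 ^ J) = 'X_i ^+ (2 ^ J) + 'X_i ^+ (2 ^ J.+1).
    rewrite expnS exprM; move: ('X_i ^+ 2) => y; elim: J {IH} => [|J IH]; first by rewrite expn0 !expr1.
    by rewrite !expnSr !exprM IH sqrP4D.
  by rewrite -addrA (addrA ('X_i ^+ (2 ^ J))) addP4K add0r.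
have := cP ((\sum_(j < D.+2) 'X_i ^+ (2 ^ j)) * 'X_[m]).
have -> : ev c ((\sum_(j < D.+2) 'X_i ^+ (2 ^ j)) * 'X_[m]) = 0.
  rewrite mulr_suml raddf_sum big1 // => j _.
  rewrite mpolyXn -mpolyXD /= evX cn // mdegD mdegMn mdeg1 mD mul1n -addnn => e.
  by apply: (D2 j); lia.
rewrite rmorphM /= chi mulrDl raddfD /= -ev_shift mpolyXn -ev_shift.
rewrite [X in _ + X]ev_eq0 ?addr0 => [|e]; last first.
  apply: cn; rewrite mdegD mdegMn mdeg1 mul1n.
  by have := ltn_expl D.+1 (isT : 1 < 2)%N; rewrite (expnS 2 D.+1); lia.
rewrite ev_St_high // mD => e eD; apply: cn; rewrite mdegD mdeg1 add1n => -[]; exact: eD.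
Qed.

(** * The recursive structure of annihilated functionals *)

Fixpoint nn s := if s is s'.+1 then ((nn s').*2 + 3)%N else 3%N.

Lemma nnE s : nn s = (2 ^ (s + 2) + 2 ^ (s + 1) - 3)%N.
Proof.
elim: s => // s IHs; rewrite /= IHs !addSn !(expnS 2 (s + _)).
have : (0 < 2 ^ s)%N by rewrite expn_gt0.
by rewrite !expnD; lia.
Qed.

Lemma odd_nn s : odd (nn s).
Proof. by case: s => //= s; rewrite oddD odd_double. Qed.

Lemma nn_gt2 s : (2 < nn s)%N.
Proof. by case: s => //= s; rewrite -addnn; lia. Qed.

Definition Mod s (c : fnl) := homdeg (nn s) c /\ prim c.

Lemma Mod_weight3 s c : Mod s.+1 c -> weight3 c.
Proof.
case=> cn cP A m A3.
have [A1 | A1] := eqVneq #|A| 1%N.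
  have /eqP/cards1P[i ->] := A1; rewrite XS1.
  apply: (@prim_kill1 (nn s).+1) => //.
    by move=> e me; apply: cn => /=; rewrite addn3 -doubleS.
  case=> [|j] e; first by move: e (nn_gt2 s); rewrite expn0; lia.
  by have := odd_nn s; rewrite -[odd _]negbK -!oddS e expnS oddM.
apply: cn; rewrite !mdegD mdeg_XS => /= e.
have /(congr1 odd) := e; rewrite addnn !oddD !odd_double addbF /=.
by move: A3 A1 (card4 A); move: #|A| => -[|[|[|[|[|k]]]]].
Qed.

Lemma Mod_slices s c : homdeg (nn s.+1) c -> weight3 c ->
  Mod s.+1 c <-> (forall i, Mod s (slice i c)) /\
                 (forall m, contr (fun i => slice i c) m = 0).
Proof.
move=> cn c3; rewrite /Mod; have cP := prim_slices cn c3; split.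
  by case=> _ /cP[dP d0]; split=> // i; split; [apply: homdeg_slice | apply: dP].
by case=> dM d0; split=> //; apply/cP; split=> // i; case: (dM i).
Qed.

Lemma Mod_slice s c i : Mod s.+1 c -> Mod s (slice i c).
Proof.
by move=> cM; have [] := (Mod_slices (proj1 cM) (Mod_weight3 cM)).1 cM.
Qed.

Lemma Mod_contr s c m : Mod s.+1 c -> contr (fun i => slice i c) m = 0.
Proof.
by move=> cM; have [] := (Mod_slices (proj1 cM) (Mod_weight3 cM)).1 cM.
Qed.

Lemma eq_prim c d : c =1 d -> prim c -> prim d.
Proof. by move=> cd cP p; rewrite -!(eq_ev cd) cP. Qed.

Lemma eq_Mod s c d : c =1 d -> Mod s c -> Mod s d.
Proof.
move=> cd [cn cP]; split; last exact: eq_prim cP.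
by move=> m mn; rewrite -cd cn.
Qed.

Section Contraction.
Variables (d : 'I_4 -> fnl).
Hypotheses (d3 : forall i, weight3 (d i)) (d0 : forall m, contr d m = 0).

Lemma XS_addU (A : {set 'I_4}) i : i \notin A -> (U_(i) + XS A)%MM = XS (i |: A).
Proof.
move=> iA; apply/mnmP => j; rewrite mnmDE mnm1E !mnmE !inE [j == i]eq_sym.
by have [<-|_] := eqVneq i j; rewrite ?(negbTE iA).
Qed.

Lemma XS_subU (A : {set 'I_4}) i m : i \in A ->
  (U_(i) + (XS A + (m + m)))%MM = (XS (A :\ i) + ((U_(i) + m) + (U_(i) + m)))%MM.
Proof.
move=> iA; apply/mnmP => j; rewrite !mnmDE mnm1E !mnmE !inE [j == i]eq_sym.
by have [<-|_] /= := eqVneq i j; rewrite ?iA; lia.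
Qed.

Lemma contr_sym i l : slice l (d i) =1 slice i (d l).
Proof.
have [-> // | il] := eqVneq i l; move=> m.
pose A := ~: [set i; l].
have iA : i \notin A by rewrite !inE eqxx.
have lA : l \notin A by rewrite !inE eqxx orbT.
have := d0 (XS A + (m + m))%MM; rewrite /contr (bigD1 i) // (bigD1 l) ?(eq_sym l) //=.
rewrite big1 ?addr0 => [|k /andP[ki kl]]; last first.
  have kA : k \in A by rewrite !inE negb_or ki kl.
  rewrite XS_subU // d3 //; move: (cardsD1 k A) (cardsC [set i; l]).
  rewrite kA cards2 il card_ord => e1 e2 e3; move: e1 e2; rewrite e3.
  by rewrite -/A => ->; lia.
rewrite !addmA !XS_addU //.
have -> : i |: A = ~: [set l].
  apply/setP => j; rewrite !inE; have [->|] := eqVneq j i; last by [].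
  by rewrite il.
have -> : l |: A = ~: [set i].
  apply/setP => j; rewrite !inE; have [->|] := eqVneq j l; last by rewrite orbF.
  by rewrite eq_sym il.
by rewrite -!addmA; apply: addF2_eq0.
Qed.

Lemma contr_diag m : contr (fun i => slice i (d i)) m = 0.
Proof.
rewrite -[RHS](d0 (XS setT + (m + m))); apply: eq_bigr => i _.
by rewrite XS_subU ?inE // setTD.
Qed.

End Contraction.

Fixpoint slw (w : seq 'I_4) (c : fnl) : fnl :=
  if w is i :: w' then slw w' (slice i c) else c.

Lemma eq_slw w c d : c =1 d -> slw w c =1 slw w d.
Proof. by elim: w c d => //= i w IHw c d cd; apply: IHw => m; apply: cd. Qed.

Lemma slw_cat u v c : slw (u ++ v) c = slw v (slw u c).
Proof. by elim: u c => //= i u IHu c; rewrite IHu. Qed.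

Lemma Mod_slw w k c : Mod (size w + k) c -> Mod k (slw w c).
Proof. by elim: w c => //= i w IHw c cM; apply: IHw; apply: Mod_slice. Qed.

Lemma slw_swap i j w s c : Mod s.+2 c -> slw [:: i, j & w] c =1 slw [:: j, i & w] c.
Proof.
move=> cM m; apply: (@eq_slw w); apply: (@contr_sym (fun i => slice i c)) => [l | x].
  exact: Mod_weight3 (Mod_slice _ cM).
exact: Mod_contr cM.
Qed.

Lemma slw_front u i v k c : Mod (size u + k.+1) c ->
  slw (i :: u ++ v) c =1 slw (u ++ i :: v) c.
Proof.
elim: u c => //= j u IHu c cM m; rewrite -IHu; last exact: Mod_slice.
by apply: (@slw_swap i j (u ++ v) (size u + k) c); move: cM; rewrite /= addnS addSn.
Qed.

Lemma slw_perm w w' k c : Mod (size w + k) c -> perm_eq w w' -> slw w c =1 slw w' c.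
Proof.
elim: w w' c => [|i u IHu] w' c cM; first by move/perm_size/esym/size0nil ->.
move=> ww'; have iw' : i \in w' by rewrite -(perm_mem ww') mem_head.
case/splitPr: iw' ww' => a b uab m.
have {}uab : perm_eq u (a ++ b).
  by move: uab; rewrite perm_sym perm_catC /= perm_cons perm_catC perm_sym.
rewrite -(@slw_front a i b (size b + k)); last first.
  by rewrite addnS addnA -size_cat -(perm_size uab).
exact: (IHu (a ++ b) (slice i c) (Mod_slice _ cM) uab).
Qed.

Lemma slw_collapse i j w c : Mod (size w).+1 c -> i \in w -> j \in w ->
  slw (i :: w) c =1 slw (j :: w) c.
Proof.
have [-> // | ij] := eqVneq i j => cM iw jw m.
have [u wu] : exists u, perm_eq w [:: i, j & u].
  exists (rem j (rem i w)); apply: (perm_trans (perm_to_rem iw)).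
  rewrite perm_cons; apply: perm_to_rem.
  have : j \in i :: rem i w by rewrite -(perm_mem (perm_to_rem iw)).
  by rewrite inE eq_sym (negbTE ij).
have szw : size w = (size u).+2 by rewrite (perm_size wu).
have pi : perm_eq (i :: w) [:: i, i, j & u] by rewrite perm_cons.
have pj : perm_eq (j :: w) [:: j, j, i & u].
  by rewrite perm_cons (perm_trans wu) // (perm_catCA [:: i] [:: j]).
rewrite (slw_perm (k := 0) _ pi) ?addn0 // (slw_perm (k := 0) _ pj) ?addn0 //=.
move: cM; rewrite szw => cM; apply: (@eq_slw u).
apply: (@contr_sym (fun i => slice i (slice i c))) => [l | x].
  exact: Mod_weight3 (Mod_slice _ (Mod_slice _ cM)).
apply: (@contr_diag (fun i => slice i c)) => y.
exact: Mod_contr cM.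
Qed.

Lemma slw_extras i0 e u c : Mod (size e + size u) c -> i0 \in u ->
  {subset e <= u} -> slw (e ++ u) c =1 slw (nseq (size e) i0 ++ u) c.
Proof.
elim: e c => //= x e IHe c cM i0u eu m.
rewrite -IHe => [|||y ye] //; first 1 last.
- exact: Mod_slice.
- by apply: eu; rewrite inE ye orbT.
apply: (@slw_collapse x i0 (e ++ u)); rewrite ?size_cat ?mem_cat ?i0u ?orbT //.
by rewrite eu ?mem_head ?orbT.
Qed.

Lemma slw_support w w' c : Mod (size w) c -> size w = size w' -> w =i w' ->
  slw w c =1 slw w' c.
Proof.
case: w => [|i0 w1]; first by move=> _ /esym/size0nil ->.
set w := i0 :: w1 => cM szw ww' m.
have normal v : size v = size w -> v =i w ->
    slw v c =1 slw (nseq (size w - size (undup w)) i0 ++ undup w) c.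
  move=> sv vw x; have [e ve] := perm_to_subseq (undup_subseq v).
  have pv : perm_eq v (e ++ undup w).
    apply: (perm_trans ve); rewrite perm_catC perm_cat2l.
    by apply: uniq_perm; rewrite ?undup_uniq // => y; rewrite !mem_undup.
  have se : (size e = size w - size (undup w))%N.
    by rewrite -sv (perm_size pv) size_cat addnK.
  rewrite (slw_perm (k := 0) _ pv) ?addn0 ?sv // -se.
  apply: slw_extras; first by rewrite -size_cat -(perm_size pv) sv.
    by rewrite mem_undup mem_head.
  by move=> y ye; rewrite mem_undup -vw (perm_mem pv) mem_cat ye.
by rewrite (normal w) // (normal w') // => y; rewrite ww'.
Qed.

Definition cword s (U : {set 'I_4}) : seq 'I_4 :=
  nseq (s - #|U|) (nth ord0 (enum U) 0) ++ enum U.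

Lemma size_cword s (U : {set 'I_4}) : (#|U| <= s)%N -> size (cword s U) = s.
Proof. by move=> Us; rewrite size_cat size_nseq -cardE subnK. Qed.

Lemma mem_cword s (U : {set 'I_4}) : U != set0 -> cword s U =i U.
Proof.
move=> U0 i; rewrite mem_cat mem_enum mem_nseq.
case: (boolP (i \in U)); rewrite ?orbT ?orbF // => iU.
apply/negP => /andP[_ /eqP ii]; case/negP: iU.
by rewrite ii -mem_enum mem_nth // -cardE card_gt0.
Qed.

Definition coords s (c : fnl) (U : {set 'I_4}) : fnl := slw (cword s U) c.

Lemma slw_coords s w c : Mod s c -> size w = s ->
  slw w c =1 coords s c [set i in w].
Proof.
move=> cM sw; case: w sw => [/= <-|i w sw m].
  by rewrite /coords /cword (_ : [set i in [::]] = set0) ?enum_set0 //; apply/setP => i; rewrite !inE.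
have U0 : [set j in i :: w] != set0.
  by apply/set0Pn; exists i; rewrite inE mem_head.
have Us : (#|[set j in i :: w]| <= s)%N by rewrite cardsE -sw card_size.
apply: slw_support => [||j]; first by rewrite sw.
  by rewrite sw size_cword.
by rewrite mem_cword // !inE.
Qed.

Definition join (h : 'I_4 -> fnl) : fnl := fun m =>
  \sum_(i < 4) if oddset m == ~: [set i] then h i (halfm m) else 0.

Lemma join_slice h i : slice i (join h) =1 h i.
Proof.
move=> m; rewrite /sl /join oddset_split halfm_split (bigD1 i) //= eqxx.
rewrite big1 ?addr0 // => j ji; case: eqP => // /setC_inj/set1_inj ij.
by rewrite ij eqxx in ji.
Qed.

Lemma join_weight3 h : weight3 (join h).
Proof.
move=> A m A3; rewrite /join oddset_split big1 // => i _.
by case: eqP => // Ai; case: A3; rewrite Ai cardsC1_4.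
Qed.

Lemma eq_join h h' : (forall i, h i =1 h' i) -> join h =1 join h'.
Proof. by move=> hh m; apply: eq_bigr => i _; case: ifP => // _; apply: hh. Qed.

Lemma homdeg_join n h : (forall i, homdeg n (h i)) -> homdeg (n.*2 + 3)%N (join h).
Proof.
move=> hn m mn; rewrite /join big1 // => i _; case: eqP => // mi; apply: hn => hm.
case: mn; rewrite -(mon_split m) !mdegD mdeg_XS mi cardsC1_4 hm.
by rewrite addnn addnC.
Qed.

Lemma weight3_join c : weight3 c -> c =1 join (fun i => slice i c).
Proof.
move=> c3 m; rewrite /join /sl.
have [m3 | m3] := eqVneq #|oddset m| 3%N.
  have [i mi] := card3_setC1 m3; rewrite (bigD1 i) //= mi eqxx -mi mon_split.
  rewrite big1 ?addr0 // => j ji; case: eqP => //; rewrite mi => /setC_inj/set1_inj ij.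
  by rewrite ij eqxx in ji.
rewrite -[in LHS](mon_split m) c3; last exact/eqP.
rewrite big1 // => i _; case: eqP => // mi.
by rewrite mi cardsC1_4 in m3.
Qed.

(* [F U] is the common value of the [s]-fold slices along words with support [U]. *)
Fixpoint recon s (F : {set 'I_4} -> fnl) : fnl :=
  if s is s'.+1 then join (fun i => recon s' (fun U => F (i |: U))) else F set0.

Lemma eq_recon s F G : (forall U, F U =1 G U) -> recon s F =1 recon s G.
Proof.
by elim: s F G => [|s IHs] F G FG; [apply: FG | apply: eq_join => i; apply: IHs].
Qed.

Lemma recon_coords s c : Mod s c -> c =1 recon s (coords s c).
Proof.
move=> cM.
suff slE k w : (size w + k = s)%N ->
    slw w c =1 recon k (fun U => coords s c ([set i in w] :|: U)).
  move=> m; rewrite -[c m]/(slw [::] c m) (slE s) //; apply: eq_recon => U x.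
  by congr (coords _ _ _ _); apply/setP => j; rewrite !inE.
elim: k w => [|k IHk] w sw m.
  by rewrite /= setU0 (slw_coords cM) // -sw addn0.
have gM : Mod k.+1 (slw w c) by apply: Mod_slw; rewrite sw.
rewrite (weight3_join (Mod_weight3 gM)) /=; apply: eq_join => i x.
rewrite -[slice i (slw w c)]/(slw [:: i] (slw w c)) -slw_cat IHk ?size_cat ?addn1 ?addSnnS //.
apply: eq_recon => U y; congr (coords _ _ _ _).
by apply/setP => j; rewrite !inE mem_cat inE orbA.
Qed.

Lemma eq_contr d d' : (forall i, d i =1 d' i) -> contr d =1 contr d'.
Proof. by move=> dd m; apply: eq_bigr => i _; apply: dd. Qed.

Lemma join_sl h i p : ev (join h) ('X_[XS (~: [set i])] * p ^+ 2) = ev (h i) p.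
Proof. by rewrite -ev_sl (eq_ev (join_slice h i)). Qed.

Lemma join_sl0 h (A : {set 'I_4}) p : #|A| <> 3%N -> ev (join h) ('X_[XS A] * p ^+ 2) = 0.
Proof. by move=> A3; rewrite -ev_sl; apply: ev_eq0 => m; apply: join_weight3. Qed.

Lemma contr_join (e : 'I_4 -> 'I_4 -> fnl) :
    (forall i l, e i l =1 e l i) -> (forall m, contr (fun i => e i i) m = 0) ->
  forall m, contr (fun i => join (e i)) m = 0.
Proof.
move=> eC e0 m; rewrite -(mon_split m) /contr.
set A := oddset m; set h := halfm m.
have [A4 | A4] := eqVneq #|A| 4%N.
  have -> : A = setT by apply/eqP; rewrite eqEcard subsetT cardsT card_ord A4.
  rewrite -[RHS](e0 h); apply: eq_bigr => i _.
  by rewrite XS_subU ?inE // setTD; apply: join_slice.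
have inA i : i \in A -> join (e i) (U_(i) + (XS A + (h + h)))%MM = 0.
  move=> iA; rewrite XS_subU // join_weight3 // => e3.
  by move: A4; rewrite (cardsD1 i) iA e3.
have [A2 | A2] := eqVneq #|A| 2%N; last first.
  rewrite big1 // => i _; have [iA|iA] := boolP (i \in A); first exact: inA.
  rewrite addmA XS_addU // join_weight3 // cardsU1 iA add1n => -[] e2.
  by rewrite e2 in A2.
have : #|~: A| = 2%N by move: (cardsC A); rewrite A2 card_ord => -[].
move/eqP/cards2P => [i [l [il Ail]]].
rewrite (bigD1 i) // (bigD1 l) ?(eq_sym l) //= big1 ?addr0 => [|k /andP[ki kl]]; last first.
  by apply: inA; rewrite -[A]setCK Ail !inE negb_or ki kl.
have iA : i \notin A by rewrite -[A]setCK Ail !inE eqxx.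
have lA : l \notin A by rewrite -[A]setCK Ail !inE eqxx orbT.
rewrite !addmA !XS_addU // -!addmA.
have -> : i |: A = ~: [set l].
  rewrite -[A]setCK Ail; apply/setP => j; rewrite !inE.
  by have [->|] := eqVneq j i; rewrite ?il.
have -> : l |: A = ~: [set i].
  rewrite -[A]setCK Ail; apply/setP => j; rewrite !inE.
  by have [->|] := eqVneq j l; rewrite ?orbF // eq_sym il.
rewrite -[join (e i) _]/(slice l (join (e i)) h) -[join (e l) _]/(slice i (join (e l)) h).
by rewrite !join_slice (eC i l) addF2K.
Qed.

Lemma contr_recon s F : (forall m, contr (fun i => F [set i]) m = 0) ->
  forall m, contr (fun i => recon s (fun U => F (i |: U))) m = 0.
Proof.
move=> F0; elim: s => [|s IHs] m /=.
  by rewrite -[RHS](F0 m); apply: eq_contr => i; rewrite setU0.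
apply: contr_join => {m} [i l|m].
  by apply: eq_recon => U; rewrite setUCA.
by rewrite -[RHS](IHs m); apply: eq_contr => i; apply: eq_recon => U; rewrite setUA setUid.
Qed.

Lemma Mod_recon s F :
    (forall w, size w = s -> Mod 0 (F [set i in w])) ->
    (forall w, (size w < s)%N -> forall m, contr (fun i => F (i |: [set j in w])) m = 0) ->
  Mod s (recon s F).
Proof.
have set_nil : [set j in [::]] = set0 :> {set 'I_4} by apply/setP => j; rewrite !inE.
have set_consE i (w : seq 'I_4) : [set j in i :: w] = i |: [set j in w].
  by apply/setP => j; rewrite !inE.
elim: s F => [|s IHs] F FM F0; first by rewrite /= -set_nil; apply: FM.
have rM i : Mod s (recon s (fun U => F (i |: U))).
  apply: IHs => [w sw | w sw m]; first by rewrite -set_consE; apply: FM; rewrite /= sw.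
  rewrite -[RHS](F0 (i :: w) _ m) //; apply: eq_contr => l.
  by rewrite setUCA -set_consE.
apply/Mod_slices; [by apply: homdeg_join => i; case: (rM i) | exact: join_weight3 |].
split=> [i | m]; first by apply: eq_Mod (rM i) => m; rewrite join_slice.
rewrite -[RHS](contr_recon s (F := F) _ m) => [|{}m].
  by apply: eq_contr => i; apply: join_slice.
by rewrite -[RHS](F0 [::] _ m) //; apply: eq_contr => i; rewrite set_nil setU0.
Qed.

Lemma Mod_coords s c (U : {set 'I_4}) : Mod s c -> (#|U| <= s)%N -> Mod 0 (coords s c U).
Proof. by move=> cM Us; apply: Mod_slw; rewrite size_cword // addn0. Qed.

Lemma contr_slices k d : (forall i, Mod k (d i)) -> (forall m, contr d m = 0) ->
  forall m, contr (fun i => slw (nseq k i) (d i)) m = 0.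
Proof.
elim: k d => // k IHk d dM d0 m; apply: (IHk (fun i => slice i (d i))) => [i|{}m].
  exact: Mod_slice.
exact: contr_diag.
Qed.

Lemma contr_coords s c (U : {set 'I_4}) : Mod s c -> (#|U| < s)%N ->
  forall m, contr (fun i => coords s c (i |: U)) m = 0.
Proof.
move=> cM Us m; pose k := (s - #|U|).-1.
have sk : (size (enum U) + k.+1 = s)%N by rewrite -cardE /k; lia.
have gM : Mod k.+1 (slw (enum U) c) by apply: Mod_slw; rewrite sk.
rewrite -[RHS](contr_slices (d := fun i => slice i (slw (enum U) c)) (k := k) _ _ m) => [|i|{}m].
- apply: eq_contr => i x; rewrite -[slw _ (slice _ _)]/(slw (nseq k.+1 i) _) -slw_cat.
  rewrite (slw_coords cM) ?size_cat ?size_nseq //.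
  congr (coords _ _ _ _); apply/setP => j; rewrite !inE mem_cat mem_enum mem_nseq.
  by rewrite ltn0Sn orbC.
- exact: Mod_slice.
- exact: Mod_contr gM.
Qed.

(** * Transvections *)

Definition tv (a b : 'I_4) (p : P4) : P4 :=
  p \mPo [tuple if j == a then 'X_a + 'X_b else 'X_j | j < 4].

HB.instance Definition _ a b := GRing.RMorphism.copy (tv a b) (comp_mpoly _).

Lemma tvXU a b j : tv a b 'X_j = if j == a then 'X_a + 'X_b else 'X_j.
Proof. by rewrite /tv comp_mpolyXU -tnth_nth tnth_mktuple. Qed.

Definition tvf a b (c : fnl) : fnl := fun m => ev c (tv a b 'X_[m]).

Lemma ev_tvf a b c p : ev (tvf a b c) p = ev c (tv a b p).
Proof.
elim/monomial_ind: p => [|p q IHp IHq|m]; first by rewrite !raddf0.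
  by rewrite !raddfD /= IHp IHq.
by rewrite evX.
Qed.

Lemma tv_prod a b (A : {set 'I_4}) : a \notin A -> tv a b 'X_[XS A] = 'X_[XS A].
Proof.
move=> aA; rewrite mpolyXS rmorph_prod; apply: eq_bigr => i iA /=.
by rewrite tvXU; case: eqP => // ia; rewrite -ia iA in aA.
Qed.

Lemma mpolyXSD1 (A : {set 'I_4}) a : a \in A -> 'X_[XS A] = 'X_a * 'X_[XS (A :\ a)] :> P4.
Proof.
move=> aA; rewrite !mpolyXS (big_setD1 a) //.
Qed.

Lemma cardsD2 (A : {set 'I_4}) a b : a \in A -> b \in A :\ a ->
  #|A| = #|A :\ a :\ b|.+2.
Proof. by move=> aA bA; rewrite (cardsD1 a A) aA (cardsD1 b (A :\ a)) bA. Qed.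

Lemma tvf_join a b h : a != b ->
  tvf a b (join h) =1
  join (fun i m => tvf a b (h i) m + (if i == b then tvf a b (h a) m else 0)).
Proof.
move=> ab m; rewrite -[in LHS](mon_split m) /tvf.
set A := oddset m; set e := halfm m.
rewrite !mpolyXD -expr2 rmorphM rmorphXn /=; set q := tv a b 'X_[e].
rewrite -[in RHS](mon_split m) -/A -/e.
pose h' i : fnl := fun m => tvf a b (h i) m + (if i == b then tvf a b (h a) m else 0).
have [A3 | A3] := eqVneq #|A| 3%N.
  have [i Ai] := card3_setC1 A3.
  rewrite Ai -[RHS]/(slice i (join h') e) join_slice /h' /tvf -/q.
  have [ia | ia] := eqVneq i a.
    by rewrite ia (negbTE ab) addr0 tv_prod ?inE ?eqxx // join_sl.
  have aA : a \in ~: [set i] by rewrite !inE eq_sym.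
  rewrite (mpolyXSD1 aA) rmorphM /= tvXU eqxx (tv_prod b) ?inE ?eqxx //.
  rewrite mulrDl -mpolyXSD1 // mulrDl raddfD /= join_sl; congr (_ + _).
  have [ib | ib] := eqVneq i b.
    have -> : ~: [set i] :\ a = ~: [set a] :\ b.
      by rewrite ib; apply/setP => j; rewrite !inE andbC.
    by rewrite -mpolyXSD1 ?join_sl // !inE eq_sym.
  have bA : b \in ~: [set i] :\ a by rewrite !inE eq_sym ab eq_sym ib.
  rewrite (_ : 'X_b * _ * _ = 'X_[XS (~: [set i] :\ a :\ b)] * ('X_b * q) ^+ 2); last first.
    by rewrite (mpolyXSD1 bA); ring.
  rewrite join_sl0 //.
  by have := cardsD2 aA bA; rewrite cardsC1_4 => -[<-].
rewrite [RHS]join_weight3; last exact/eqP.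
have [aA | aA] := boolP (a \in A); last by rewrite tv_prod // join_sl0 //; apply/eqP.
rewrite (mpolyXSD1 aA) rmorphM /= tvXU eqxx (tv_prod b) ?inE ?eqxx //.
rewrite mulrDl -mpolyXSD1 // mulrDl raddfD /= join_sl0 ?add0r; last exact/eqP.
have := cardsD1 a A; rewrite aA => cA.
have [bA | bA] := boolP (b \in A :\ a).
  rewrite (_ : 'X_b * _ * _ = 'X_[XS (A :\ a :\ b)] * ('X_b * q) ^+ 2); last first.
    by rewrite (mpolyXSD1 bA); ring.
  rewrite join_sl0 //.
  by move=> e3; have := card4 A; rewrite (cardsD2 aA bA) e3.
have -> : 'X_b * 'X_[XS (A :\ a)] = 'X_[XS (b |: A :\ a)] :> P4.
  by rewrite -mpolyXD XS_addU.
by rewrite join_sl0 // cardsU1 bA => e3; move/eqP: A3; rewrite cA e3.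
Qed.

Definition tvF a b (F : {set 'I_4} -> fnl) (U : {set 'I_4}) : fnl := fun m =>
  tvf a b (F U) m + (if b \in U then tvf a b (F (a |: U :\ b)) m else 0).

Lemma recon_add s F G m : recon s F m + recon s G m =
  recon s (fun U m => F U m + G U m) m.
Proof.
elim: s F G m => //= s IHs F G m; rewrite /join -big_split; apply: eq_bigr => i _.
by case: ifP => _; [apply: IHs | apply: addr0].
Qed.

Lemma tvf_recon a b s F : a != b -> tvf a b (recon s F) =1 recon s (tvF a b F).
Proof.
move=> ab; elim: s F => [|s IHs] F m /=; first by rewrite /tvF inE addr0.
rewrite tvf_join //; apply: eq_join => i {}m.
rewrite !IHs.
have [ib | ib] := eqVneq i b; last first.
  rewrite addr0; apply: (@eq_recon s (tvF a b (fun U => F (i |: U))) (fun U => tvF a b F (i |: U))) => U x; rewrite /tvF !inE eq_sym (negbTE ib) /=.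
  case: ifP => // bU; congr (_ + tvf a b (F _) x).
  by apply/setP => j; rewrite !inE; have [->|] := eqVneq j i; rewrite ?ib ?orbT.
rewrite recon_add; apply: (@eq_recon s _ (fun U => tvF a b F (i |: U))) => U x; rewrite ib /tvF !inE eqxx /=.
case: ifP => bU; last first.
  rewrite !addr0; congr (_ + tvf a b (F _) x).
  apply/setP => j; rewrite !inE; have [-> | //] := eqVneq j b.
  by rewrite bU.
rewrite -addrA; congr (_ + _).
have -> : b |: (a |: U :\ b) = a |: U.
  apply/setP => j; rewrite !inE; have [-> | _] := eqVneq j b; first by rewrite bU orbT.
  by [].
rewrite addrA addF2K add0r; congr (tvf a b (F _) x).
by apply/setP => j; rewrite !inE; case: (j == a) => //=; case: (j == b).
Qed.

(** * Generation of the general linear group by transvections *)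

Definition transv n (a b : 'I_n) : 'M['F_2]_n := 1%:M + delta_mx b a.

Lemma mul_transvE n (g : 'M['F_2]_n) a b i j :
  (g *m transv a b) i j = g i j + (if j == a then g i b else 0).
Proof.
rewrite mulmxDr mulmx1 !mxE; congr (_ + _).
rewrite (bigD1 b) //= mxE eqxx big1 ?addr0 => [|k kb]; last first.
  by rewrite mxE (negbTE kb) mulr0.
by case: (j == a); rewrite ?mulr1 ?mulr0.
Qed.

Lemma transvK n (a b : 'I_n) : a != b -> transv a b *m transv a b = 1%:M.
Proof.
move=> ab; apply/matrixP => i j; rewrite mul_transvE !mxE.
have [-> | ja] := eqVneq j a; rewrite ?andbF ?addr0 //.
by rewrite andbT [b == a]eq_sym (negbTE ab) andbF addr0 -addrA addF2K addr0.
Qed.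

Lemma GL_ind n (H : 'M['F_2]_n -> Prop) :
    H 1%:M -> (forall g a b, a != b -> H g -> H (g *m transv a b)) ->
  forall g, g \in unitmx -> H g.
Proof.
move=> H1 HM.
have HV g a b : a != b -> H (g *m transv a b) -> H g.
  by move=> ab /(HM _ a b ab); rewrite -mulmxA transvK // mulmx1.
have unitM g (a b : 'I_n) : a != b -> g \in unitmx -> g *m transv a b \in unitmx.
  move=> ab gU; rewrite unitmx_mul gU /=.
  by have := mulmx1_unit (transvK ab) => -[].
pose Id k (g : 'M['F_2]_n) := forall i j : 'I_n, (i < k)%N -> g i j = (i == j)%:R.
suff key d k g : (k + d = n)%N -> g \in unitmx -> Id k g -> H g.
  by move=> g gU; apply: (key n 0).
elim: d k g => [|d IHd] k g.
  rewrite addn0 => -> _ gI; rewrite (_ : g = 1%:M) //.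
  by apply/matrixP => i j; rewrite gI // mxE.
move=> kd; have kn : (k < n)%N by rewrite -kd; lia.
pose k' := Ordinal kn.
have pivot c (g1 : 'M['F_2]_n) : #|[set j | (j != k') && (g1 k' j != 0)]| = c ->
    g1 \in unitmx -> Id k g1 -> g1 k' k' = 1 -> H g1.
  elim/ltn_ind: c g1 => c IHc g1 cE gU gI gk.
  have [j /andP[jk gj] | none] := pickP [pred j | (j != k') && (g1 k' j != 0)]; last first.
    apply: (IHd k.+1) => // [|i j]; first by rewrite addSnnS.
    rewrite ltnS leq_eqVlt => /orP[/eqP ik | /gI //].
    have -> : i = k' by apply: val_inj.
    have [<- // | kj] := eqVneq k' j.
    by have := none j; rewrite /= eq_sym kj /= => /negbFE/eqP.
  apply: (HV _ j k' jk); apply: (IHc _ _ _ erefl).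
  - rewrite -cE; apply: proper_card; apply/properP; split.
      apply/subsetP => l; rewrite !inE mul_transvE => /andP[-> /=].
      by have [-> _ | _] := eqVneq l j; rewrite ?addr0.
    exists j; rewrite !inE ?jk // mul_transvE eqxx gk /= negbK.
    by case: (F2_cases (g1 k' j)) gj => -> //; rewrite addF2K.
  - exact: unitM.
  - move=> i l ik; rewrite mul_transvE !gI //.
    have -> : (i == k') = false by apply/eqP => e; rewrite e ltnn in ik.
    by rewrite if_same addr0.
  - by rewrite mul_transvE eq_sym (negbTE jk) addr0.
move=> gU gI; have [gk | gk] := F2_cases (g k' k'); last exact: (pivot _ g erefl).
have [j /andP[kj gj] | none] := pickP [pred j : 'I_n | (k < j)%N && (g k' j != 0)].
  have jk : j != k' by apply/eqP => e; rewrite e /= ltnn in kj.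
  have kj' : k' != j by rewrite eq_sym.
  apply: (HV _ k' j kj'); apply: (pivot _ _ erefl); first exact: unitM.
    move=> i l ik; rewrite mul_transvE !gI //.
    have -> : (i == j) = false by apply/eqP => e; rewrite e ltnNge ltnW in ik.
    by rewrite if_same addr0.
  rewrite mul_transvE eqxx gk add0r.
  by case: (F2_cases (g k' j)) gj => ->; rewrite ?eqxx.
pose v : 'rV['F_2]_n := \row_j if j == k' then 1 else if (j < k)%N then g k' j else 0.
suff v0 : v = 0 by have := congr1 (fun v : 'rV_n => v 0 k') v0; rewrite !mxE eqxx => /eqP.
rewrite -[v]mulmx1 -(mulmxV gU) mulmxA (_ : v *m g = 0) ?mul0mx //.
apply/rowP => l; rewrite !mxE (bigD1 k') //= !mxE eqxx mul1r.
rewrite (bigID (fun j : 'I_n => (j < k)%N)) /= [X in _ + (_ + X)]big1 ?addr0; last first.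
  by move=> j /andP[jk jlt]; rewrite mxE (negbTE jk) (negbTE jlt) mul0r.
rewrite (eq_bigr (fun j => g k' j * (j == l)%:R)); last first.
  by move=> j /andP[jk jlt]; rewrite mxE (negbTE jk) jlt gI.
have [lk | kl] := ltnP l k.
  rewrite (bigD1 l) /=; last by rewrite lk andbT; apply/eqP => e; rewrite e ltnn in lk.
  rewrite eqxx mulr1 big1 ?addr0 ?addF2K // => j /andP[_ jl].
  by rewrite (negbTE jl) mulr0.
rewrite big1 ?addr0 => [|j /andP[_ jk]]; last first.
  by case: eqP => [e|]; rewrite ?mulr0 //; move: jk; rewrite e ltnNge kl.
move: kl; rewrite leq_eqVlt => /orP[/eqP kl | kl].
  by rewrite (_ : l = k') //; apply: val_inj.
by have := none l; rewrite /= kl /= => /negbFE/eqP.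
Qed.

(** * Functionals as elements of the dual *)

Definition toF n (f : Dual n) : fnl := fun m => pairing f 'X_[m].
Definition ofF n (c : fnl) : Dual n := [ffun u => c (mono u)].

Lemma pairing_add n (f : Dual n) p q : pairing f (p + q) = pairing f p + pairing f q.
Proof.
by rewrite /pairing -big_split; apply: eq_bigr => u _; rewrite mcoeffD mulrDr.
Qed.

Lemma pairingE n (f : Dual n) p : pairing f p = ev (toF f) p.
Proof.
elim/monomial_ind: p => [|p q IHp IHq|m]; last by rewrite evX.
  by rewrite raddf0 /pairing big1 // => u _; rewrite mcoeff0 mulr0.
by rewrite pairing_add IHp IHq raddfD.
Qed.

Lemma toF_mono n (f : Dual n) u : toF f (mono u) = f u.
Proof.
rewrite /toF /pairing (bigD1 u) //= mcoeffX eqxx mulr1 big1 ?addr0 // => v vu.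
by rewrite mcoeffX (inj_eq (@mono_inj n)) eq_sym (negbTE vu) mulr0.
Qed.

Lemma homdeg_toF n (f : Dual n) : homdeg n (toF f).
Proof.
move=> m mn; rewrite /toF /pairing big1 // => u _; rewrite mcoeffX.
by case: eqP => [e|]; rewrite ?mulr0 //; case: mn; rewrite e mdeg_mono.
Qed.

Lemma toF_ofF n c : homdeg n c -> toF (ofF n c) =1 c.
Proof.
move=> cn m; have [/mono_surj[u <-] | mn] := eqVneq (mdeg m) n.
  by rewrite toF_mono ffunE.
by rewrite (homdeg_toF (ofF n c)) ?cn //; apply/eqP.
Qed.

Lemma toF_inj n (f f' : Dual n) : toF f =1 toF f' -> f = f'.
Proof. by move=> ff; apply/ffunP => u; rewrite -!toF_mono. Qed.

Lemma toFD n (f f' : Dual n) m : toF (f + f') m = toF f m + toF f' m.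
Proof.
by rewrite /toF /pairing -big_split; apply: eq_bigr => u _; rewrite ffunE mulrDl.
Qed.

Lemma oppDual n (f : Dual n) : - f = f.
Proof. by apply/ffunP => u; rewrite ffunE; case: (F2_cases (f u)) => ->; apply/val_inj. Qed.

Lemma primbP n (f : Dual n) : reflect (prim (toF f)) (primb f).
Proof.
have fn := homdeg_toF f.
apply: (iffP forallP) => [fP | fP i].
  apply: primX => m; have [mn | nm] := ltnP (mdeg m) n; last exact: ev_St_low fn nm.
  have im : (n - mdeg m < n.+1)%N by rewrite ltnS leq_subr.
  have := fP (Ordinal im); rewrite /= subn_gt0 mn => /forallP.
  have mE : mdeg m = (n - (n - mdeg m))%N by rewrite subKn // ltnW.
  have [u um] := mono_surj mE.
  move=> /(_ u)/eqP; rewrite um pairingE (ev_Sq fn) ?subnKC ?(ltnW mn) // => ->.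
  by rewrite fn // => e; rewrite e ltnn in mn.
apply/implyP => i0; apply/forallP => u; rewrite pairingE (ev_Sq fn); last first.
  by rewrite mdeg_mono subnK // -ltnS ltn_ord.
rewrite fP evX fn // mdeg_mono; have : (val i <= n)%N by rewrite -ltnS ltn_ord.
by move: i0; move: (val i) => j; lia.
Qed.

Lemma ev_homog n k c p : homdeg n c -> p \is k.-homog -> k != n -> ev c p = 0.
Proof.
move=> cn /dhomogP pk kn; rewrite /ev big_seq big1 // => m /pk mk.
by rewrite cn ?mulr0 // => e; rewrite -e -mk eqxx in kn.
Qed.

Lemma act_homog g m : act g 'X_[m] \is (mdeg m).-homog.
Proof.
rewrite /act comp_mpolyX mdegE.
elim/big_rec2: _ => [|i p k _ IH]; first exact: dhomog1.
apply: dhomogM IH; rewrite -[X in X.-homog]mul1n; apply: dhomogMn.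
rewrite tnth_mktuple; apply: rpred_sum => j _; apply: rpredZ.
by rewrite dhomogX /= mdeg1.
Qed.

Lemma eq_rmorphP4 (phi psi : {rmorphism P4 -> P4}) :
  (forall i, phi 'X_i = psi 'X_i) -> phi =1 psi.
Proof.
move=> eqX; elim/monomial_ind => [|p q IHp IHq|m]; first by rewrite !raddf0.
  by rewrite !raddfD /= IHp IHq.
by rewrite mpolyXE_id !rmorph_prod; apply: eq_bigr => i _; rewrite !rmorphXn eqX.
Qed.

HB.instance Definition _ g := GRing.RMorphism.copy (act g) (comp_mpoly _).

Lemma actXU g i : act g 'X_i = \sum_(k < 4) g k i *: 'X_k.
Proof. by rewrite /act comp_mpolyXU -tnth_nth tnth_mktuple. Qed.

Lemma act_mul g t p : act (g *m t) p = act g (act t p).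
Proof.
apply: (eq_rmorphP4 (phi := act (g *m t)) (psi := act g \o act t)) => i /=.
rewrite !actXU raddf_sum /=.
under [RHS]eq_bigr => j _.
  rewrite [act g _]comp_mpolyZ -[_ \mPo _]/(act g 'X_j) actXU scaler_sumr.
  under eq_bigr => k _ do rewrite scalerA mulrC.
  over.
rewrite exchange_big; apply: eq_bigr => k _ /=.
by rewrite mxE scaler_suml.
Qed.

Lemma act1 p : act 1%:M p = p.
Proof.
apply: (eq_rmorphP4 (phi := act 1%:M) (psi := idfun)) => i /=.
rewrite actXU (bigD1 i) //= mxE eqxx scale1r big1 ?addr0 // => j ji.
by rewrite mxE (negbTE ji) scale0r.
Qed.

Lemma act_transv a b p : a != b -> act (transv a b) p = tv a b p.
Proof.
move=> ab; apply: (eq_rmorphP4 (phi := act (transv a b)) (psi := tv a b)) => i /=.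
rewrite actXU tvXU.
under eq_bigr => k _ do rewrite mxE scalerDl.
rewrite big_split /= -actXU act1; have [-> | ia] := eqVneq i a.
  congr (_ + _); rewrite (bigD1 b) //= mxE !eqxx scale1r big1 ?addr0 // => j jb.
  by rewrite mxE (negbTE jb) scale0r.
by rewrite big1 ?addr0 // => j _; rewrite mxE (negbTE ia) andbF scale0r.
Qed.

Lemma St_tv a b p : St (tv a b p) = tv a b (St p).
Proof.
apply: (eq_rmorphP4 (phi := St \o tv a b) (psi := tv a b \o St)) => i /=.
rewrite !tvXU StXU rmorphD rmorphXn /= !tvXU.
by case: eqP => _; rewrite ?rmorphD /= !StXU // sqrP4D addrACA.
Qed.

(* Plain rewriting would here compare substitution morphisms by conversion. *)
Lemma prim_tvf a b c : prim c -> prim (tvf a b c).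
Proof.
move=> cP p; apply: etrans (ev_tvf _ _ _ _) _; apply: etrans (esym (ev_tvf _ _ _ _)).
exact (etrans (congr1 (ev c) (esym (St_tv a b p))) (cP (tv a b p))).
Qed.

Lemma pairing_dact n g (f : Dual n) p : pairing (dact g f) p = pairing f (act g p).
Proof.
elim/monomial_ind: p => [|p q IHp IHq|m].
- by rewrite raddf0 !pairingE !raddf0.
- by rewrite raddfD /= !pairing_add IHp IHq.
have [/mono_surj[u <-] | mn] := eqVneq (mdeg m) n.
  by rewrite -[LHS]/(toF (dact g f) (mono u)) toF_mono ffunE.
rewrite -[LHS]/(toF (dact g f) m) homdeg_toF; last exact/eqP.
by rewrite pairingE (ev_homog (homdeg_toF f) (act_homog g m)).
Qed.

Lemma dact_mul n g t (f : Dual n) : dact (g *m t) f = dact t (dact g f).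
Proof.
apply: toF_inj => m.
apply: etrans (pairing_dact _ _ _) _; apply: etrans (congr1 (pairing f) (act_mul g t _)) _.
by apply: esym; apply: etrans (pairing_dact _ _ _) _; apply: (pairing_dact g f).
Qed.

Lemma dact1 n (f : Dual n) : dact 1%:M f = f.
Proof.
by apply: toF_inj => m; exact (etrans (pairing_dact _ _ _) (congr1 (pairing f) (act1 _))).
Qed.

Lemma toF_transv n a b (f : Dual n) : a != b ->
  toF (dact (transv a b) f) =1 tvf a b (toF f).
Proof.
move=> ab m; apply: etrans (pairing_dact _ _ _) _.
exact (etrans (congr1 (pairing f) (act_transv _ ab)) (pairingE _ _)).
Qed.

Lemma primb_transv n a b (f : Dual n) : a != b -> primb f -> primb (dact (transv a b) f).
Proof.
move=> ab /primbP fP; apply/primbP.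
have e : tvf a b (toF f) =1 toF (dact (transv a b) f) by move=> m; apply/esym/toF_transv.
exact: eq_prim e (prim_tvf a b fP).
Qed.

Lemma primb_dact n g (f : Dual n) : g \in unitmx -> primb f -> primb (dact g f).
Proof.
move=> gU fP; elim/GL_ind: gU => [|h a b ab hP]; first by rewrite dact1.
by rewrite dact_mul primb_transv.
Qed.

Lemma invariant_dact n (Psi : Dual n -> 'F_2) :
    (forall a b f, a != b -> primb f -> Psi (dact (transv a b) f) = Psi f) ->
  forall g f, g \in unitmx -> primb f -> Psi (dact g f) = Psi f.
Proof.
move=> inv g f gU fP.
suff [] : primb (dact g f) /\ Psi (dact g f) = Psi f by [].
elim/GL_ind: gU => [|h a b ab [hP hE]]; first by rewrite dact1.
rewrite dact_mul; split; first exact: primb_transv.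
exact: etrans (inv _ _ _ ab hP) hE.
Qed.

Lemma mem_prim_list n (f : Dual n) : (f \in prim_list n) = primb f.
Proof. by rewrite mem_filter mem_enum andbT. Qed.

Lemma coinv_rel_mem n g (f : Dual n) : g \in unitmx -> primb f ->
  dact g f - f \in coinv_rel n.
Proof.
move=> gU fP; apply: memv_span; apply/allpairsP; exists (f, g).
by rewrite mem_prim_list mem_filter mem_enum gU fP.
Qed.

Lemma coinv_rel_sub n (V : {vspace Dual n}) :
    (forall g f, g \in unitmx -> primb f -> dact g f - f \in V) ->
  (coinv_rel n <= V)%VS.
Proof.
move=> gV; apply/span_subvP => _ /allpairsP[[f g] /= [fP gU ->]].
by apply: gV; [move: gU; rewrite mem_filter => /andP[] | rewrite -mem_prim_list].
Qed.

Lemma PA_sub n (V : {vspace Dual n}) : (forall f, primb f -> f \in V) -> (PA n <= V)%VS.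
Proof. by move=> fV; apply/span_subvP => f; rewrite mem_prim_list; apply: fV. Qed.

Lemma coinv_dim_eq0 n : (forall f : Dual n, primb f -> f \in coinv_rel n) ->
  coinv_dim n = 0%N.
Proof. by move=> /PA_sub PC; apply/eqP; rewrite subn_eq0 dimvS. Qed.

Lemma coinv_dim_eq1 n (f0 : Dual n) (Psi : Dual n -> 'F_2) :
    (forall f f', Psi (f + f') = Psi f + Psi f') -> primb f0 -> Psi f0 = 1 ->
    (forall a b f, a != b -> primb f -> Psi (dact (transv a b) f) = Psi f) ->
    (forall f, primb f -> f \in (<[f0]> + coinv_rel n)%VS) ->
  coinv_dim n = 1%N.
Proof.
move=> PsiD f0P Psi1 inv PC.
have f0PA : f0 \in PA n by rewrite memv_span // mem_prim_list.
have CPA : (coinv_rel n <= PA n)%VS.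
  apply: coinv_rel_sub => g f gU fP.
  by rewrite rpredB // memv_span // mem_prim_list ?primb_dact.
have f0C : f0 \notin coinv_rel n.
  apply/negP => f0C; have Psi0 : Psi 0 = 0.
    by have := addF2K (Psi 0); rewrite -PsiD addr0.
  have : Psi f0 = 0.
    have f0S : f0 \in <<in_tuple [seq dact g f - f | f <- prim_list n, g <- GL4]>>%VS by [].
    rewrite (coord_span f0S); apply: (big_ind (fun f => Psi f = 0)) => // [f f' e e' | i _].
      by rewrite PsiD e e' addr0.
    move: (coord _ i f0) => k; case: (F2_cases k) => ->; first by rewrite scale0r.
    rewrite scale1r; have /allpairsP[[f g] /= [fP gU ->]] := mem_nth 0 (ltn_ord i).
    rewrite mem_prim_list in fP; rewrite mem_filter in gU; case/andP: gU => gU _.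
    by rewrite PsiD oppDual (invariant_dact inv gU fP) addF2K.
  by rewrite Psi1 => /eqP; rewrite oner_eq0.
rewrite /coinv_dim; have -> : PA n = (<[f0]> + coinv_rel n)%VS :> {vspace _}.
  apply: subv_anti; rewrite PA_sub //= subv_add CPA andbT.
  by apply/subvP => _ /vlineP[k ->]; apply: rpredZ.
suff -> : \dim (<[f0]> + coinv_rel n) = (\dim (coinv_rel n)).+1.
  by rewrite subSn // subnn.
rewrite dimv_disjoint_sum ?dim_vline; last first.
  apply/eqP; rewrite -subv0; apply/subvP => x; rewrite memv_cap => /andP[/vlineP[k ->]].
  by case: (F2_cases k) => ->; rewrite ?scale0r ?mem0v // scale1r (negbTE f0C).
by rewrite (_ : f0 != 0) //; apply: contraNneq f0C => ->; apply: mem0v.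
Qed.

(** * Linear algebra over bit vectors *)

Fixpoint xorv (u v : seq bool) : seq bool :=
  if u is a :: u' then if v is b :: v' then (a (+) b) :: xorv u' v' else u else v.

Fixpoint dot (u v : seq bool) : bool :=
  if u is a :: u' then if v is b :: v' then (a && b) (+) dot u' v' else false else false.

(* An echelon system lists, for every position [p], the row whose pivot is [p],
   stripped of its first [p] (zero) entries; [[::]] stands for no row. *)
Fixpoint reduce (E : seq (seq bool)) (v : seq bool) : seq bool :=
  if E is r :: E' then
    if v is b :: v' then
      if b && (r != [::]) then false :: reduce E' (xorv v' (behead r))
      else b :: reduce E' v'
    else [::]
  else v.

Fixpoint insert (E : seq (seq bool)) (v : seq bool) : seq (seq bool) :=
  if E is r :: E' then
    if v is b :: v' then
      if b then
        if r is _ :: r' then r :: insert E' (xorv v' r') else v :: E'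
      else r :: insert E' v'
    else E
  else [::].

Fixpoint kern (E : seq (seq bool)) : seq (seq bool) :=
  if E is r :: E' then
    if r is _ :: r' then [seq dot r' v :: v | v <- kern E']
    else (true :: nseq (size E') false) :: [seq false :: v | v <- kern E']
  else [::].

Definition echelon d (vs : seq (seq bool)) := foldl insert (nseq d [::]) vs.

Definition vanishes (v : seq bool) := all negb v.

(** * The finite model *)

Fixpoint words (T : Type) n (s : seq T) : seq (seq T) :=
  if n is n'.+1 then [seq x :: w | x <- s, w <- words n' s] else [:: [::]].

Definition subs : seq (seq bool) := Eval compute in words 4 [:: false; true].
Definition monos k : seq (seq nat) := [seq e <- words 4 (iota 0 k.+1) | sumn e == k].
Definition cubics : seq (seq nat) := Eval compute in monos 3.

(* A coordinate is a pair of a set [U] of variables and a cubic monomial [e]. *)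
Definition posn (U : seq bool) (e : seq nat) := (20 * index U subs + index e cubics)%N.

Definition allowed t (U : seq bool) := (0 < count id U <= t)%N.
Definition addl i (U : seq bool) := set_nth false U i true.
Definition incr i (e : seq nat) := set_nth 0%N e i (nth 0%N e i).+1.

Definition relations t : seq (seq nat) :=
  [seq [:: posn U e] | U <- [seq U <- subs | ~~ allowed t U], e <- cubics]
  ++ [seq [:: posn U (incr ij.1 (incr ij.1 (incr ij.2 (nseq 4 0%N))));
              posn U (incr ij.2 (incr ij.1 (incr ij.2 (nseq 4 0%N))))]
       | U <- [seq U <- subs | allowed t U],
         ij <- [seq (i, j) | i <- iota 0 4, j <- iota 0 4]]
  ++ [seq [seq posn (addl i U) (incr i e) | i <- iota 0 4]
       | U <- [seq U <- subs | (count id U < t)%N], e <- monos 2].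

Fixpoint toggle p (f : seq bool) : seq bool :=
  if f is b :: f' then if p is p'.+1 then b :: toggle p' f' else ~~ b :: f' else [::].

Definition form (ps : seq nat) : seq bool := foldr toggle (nseq 320 false) ps.

Definition xors (s : seq bool) := foldr addb false s.

Definition rowU t a b (U : seq bool) : seq nat :=
  if allowed t U then
    index U subs ::
      (if nth false U b then [:: index (addl a (set_nth false U b false)) subs] else [::])
  else [::].

Definition movem a b k (e : seq nat) : seq nat :=
  set_nth 0%N (set_nth 0%N e a (nth 0%N e a - k)%N) b (nth 0%N e b + k)%N.

Definition rowM a b (e : seq nat) : seq nat :=
  [seq index (movem a b k e) cubics | k <- iota 0 (nth 0%N e a).+1
                                       & odd 'C(nth 0%N e a, k)].

Definition transvect t a b : seq bool -> seq bool :=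
  let tU := [seq rowU t a b U | U <- subs] in
  let tM := [seq rowM a b e | e <- cubics] in
  fun x => let y := reshape (nseq 16 20) x in
  flatten [seq [seq xors [seq nth false (nth [::] y u) j | u <- us, j <- js] | js <- tM] | us <- tU].

Definition transpose t a b : seq bool -> seq bool :=
  let tU := [seq rowU t a b U | U <- subs] in
  let tM := [seq rowM a b e | e <- cubics] in
  fun f => form (flatten [seq (if c.1 then [seq (20 * u + j)%N | u <- c.2.1, j <- c.2.2] else [::])
          | c <- zip f [seq (us, js) | us <- tU, js <- tM]]).

Definition gens t (K : seq (seq bool)) : seq (seq bool) :=
  flatten [seq (let T := transvect t ab.1 ab.2 in [seq xorv (T x) x | x <- K])
           | ab <- [:: (0, 1); (1, 2); (2, 3); (3, 0)]%N].

Definition Rsys t := echelon 320 (map form (relations t)).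

(* [kern L] spans the forms vanishing on [L]; so, by double annihilation, the rows
   of [L] span the solutions of [R] when all these forms reduce to zero. *)
Definition spanned (R L : seq (seq bool)) := all (fun f => vanishes (reduce R f)) (kern L).

Definition consistent t (R : seq (seq bool)) :=
  all (fun ps => vanishes (reduce R (form ps))) (relations t).

Definition check0 t : bool :=
  let R := Rsys t in
  consistent t R && spanned R (echelon 320 (gens t (kern R))).

(* [psi] is an invariant form which does not follow from the relations; it takes
   the value 1 on the solution [f0], which spans the coinvariants. *)
Definition check1 t : bool :=
  let R := Rsys t in
  let K := kern R in
  let L := echelon 320 (gens t K) in
  let kL := kern L in
  let psi := nth [::] kL (find (fun f => ~~ vanishes (reduce R f)) kL) in
  let f0 := nth [::] K (find (dot psi) K) in
  [&& consistent t R, dot psi f0, size psi == 320%N, f0 \in K, spanned R (insert L f0) &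
      all (fun a => all (fun b => (a == b) ||
        vanishes (reduce R (xorv (transpose t a b psi) psi))) (iota 0 4)) (iota 0 4)].
Lemma size_xorv u v : size u = size v -> size (xorv u v) = size v.
Proof. by elim: u v => [|a u IHu] [|b v] //= [/IHu ->]. Qed.

Lemma nth_xorv u v p : nth false (xorv u v) p = nth false u p (+) nth false v p.
Proof.
elim: u v p => [|a u IHu] [|b v] [|p] //=; rewrite ?addbF //.
Qed.

Lemma xorvK u v : size u = size v -> xorv (xorv u v) v = u.
Proof. by elim: u v => [|a u IHu] [|b v] //= [/IHu ->]; rewrite addbK. Qed.

Lemma xorv_prefix w u v : xorv (w ++ u) (nseq (size w) false ++ v) = w ++ xorv u v.
Proof. by elim: w => //= a w ->; rewrite addbF. Qed.

Lemma dotC u v : dot u v = dot v u.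
Proof. by elim: u v => [|a u IHu] [|b v] //=; rewrite andbC IHu. Qed.

Lemma dot_xorv u v w : size u = size v -> dot (xorv u v) w = dot u w (+) dot v w.
Proof.
elim: u v w => [|a u IHu] [|b v] [|c w] //= [uv].
by rewrite IHu // andb_addl addbACA.
Qed.

Lemma dot0 n w : dot (nseq n false) w = false.
Proof. by elim: n w => [|n IHn] [|c w] //=. Qed.

Lemma dot_prefix w u v : dot (nseq (size w) false ++ u) (w ++ v) = dot u v.
Proof. by elim: w => //= a w ->. Qed.

Section Echelon.
Variables (d : nat) (P : seq bool -> Prop).
Hypothesis PD : forall u v, P u -> P v -> P (xorv u v).
Hypothesis Psize : forall u, P u -> size u = d.

Fixpoint rowsP k (E : seq (seq bool)) : Prop :=
  if E is r :: E' then
    (r != [::] -> head false r /\ P (nseq k false ++ r)) /\ rowsP k.+1 E'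
  else True.

Lemma nseqSr k (v : seq bool) : nseq k false ++ false :: v = nseq k.+1 false ++ v.
Proof. by elim: k => //= k ->. Qed.

Lemma xorv_row k (u v : seq bool) :
  xorv (nseq k false ++ u) (nseq k false ++ v) = nseq k false ++ xorv u v.
Proof. by rewrite -[in X in xorv _ X](size_nseq k false) xorv_prefix. Qed.

Lemma reduceP E w v : (size w + size v)%N = d -> rowsP (size w) E ->
  P (w ++ v) <-> P (w ++ reduce E v).
Proof.
elim: E w v => //= r E IHE w [|b v] // wv [rP EP].
have cat1 c u : w ++ c :: u = rcons w c ++ u by rewrite cat_rcons.
have sz c : size (rcons w c) = (size w).+1 by rewrite size_rcons.
have step c u : size u = size v -> P (w ++ c :: u) <-> P (w ++ c :: reduce E u).
  by move=> uv; rewrite !cat1; apply: IHE; rewrite sz ?uv ?addSnnS.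
case: ifP => [/andP[-> r0] | _]; last exact: step.
have [] := rP r0; case: r {rP} r0 => // c r _ /= -> rP.
have vr : size v = size r.
  by move: (Psize rP); rewrite size_cat size_nseq -wv /= => /addnI [].
rewrite -step ?size_xorv //; split=> vP; have := PD vP rP; rewrite xorv_prefix //=.
by rewrite xorvK.
Qed.

Lemma rowsP_nseq k n : rowsP k (nseq n [::]).
Proof. by elim: n k => //= n IHn k. Qed.

Lemma insertP E k v : rowsP k E -> P (nseq k false ++ v) -> rowsP k (insert E v).
Proof.
elim: E k v => //= r E IHE k [|b v] // [rP EP] vP.
case: b vP => vP; last by split=> //; apply: IHE => //; rewrite -nseqSr.
case: r rP => [|c r] rP; first by split.
have [//|/= -> crP] := rP _; split=> //; apply: IHE => //.
by have := PD vP crP; rewrite xorv_row -nseqSr.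
Qed.

Lemma echelonP vs : (forall v, v \in vs -> P v) -> rowsP 0 (echelon d vs).
Proof.
rewrite /echelon; move: (nseq d [::]) (rowsP_nseq 0 d) => E.
elim: vs E => //= v vs IHvs E EP vP; apply: IHvs; last first.
  by move=> u uvs; apply: vP; rewrite inE uvs orbT.
by apply: insertP => //; apply: vP; rewrite mem_head.
Qed.

Hypothesis P0 : P (nseq d false).

Lemma kern_span E k v : rowsP k E -> size v = size E -> (k + size E)%N = d ->
  (forall f, f \in kern E -> dot f v = false) -> P (nseq k false ++ v).
Proof.
elim: E k v => [|r E IHE] k [|b v] //=; first by rewrite addn0 cats0 => _ _ ->.
move=> [rP EP] [vE] kd fv.
have kd' : (k.+1 + size E)%N = d by rewrite addSnnS.
case: r rP fv => [_ | c r rP] fv.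
  have := fv _ (mem_head _ _); rewrite /= dot0 addbF => ->.
  rewrite nseqSr; apply: IHE => // f fE.
  by rewrite -(fv (false :: f)) // inE map_f ?orbT.
have [//|/= cT] := rP _; rewrite {c}cT in rP * => rowP.
have rv : size r = size v.
  have := Psize rowP; rewrite size_cat size_nseq -kd /= => /addnI [->].
  by rewrite vE.
case: b fv => fv; last first.
  rewrite nseqSr; apply: IHE => // f fE.
  by rewrite -(fv (dot r f :: f)) ?map_f //= andbF.
suff xP : P (nseq k.+1 false ++ xorv v r).
  by have := PD xP rowP; rewrite -nseqSr xorv_row /= xorvK.
apply: IHE => // [|f fE]; first by rewrite size_xorv // rv.
have := fv _ (map_f (fun v => dot r v :: v) fE); rewrite /= andbT => <-.
by rewrite dotC dot_xorv // [dot v f]dotC addbC.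
Qed.

End Echelon.

Fixpoint orth (E : seq (seq bool)) (v : seq bool) : Prop :=
  if E is r :: E' then
    (r != [::] -> dot r v = false) /\ orth E' (behead v)
  else True.

Lemma orth0 E : orth E (nseq (size E) false).
Proof. by elim: E => //= r E IHE; split=> // _; rewrite dotC (dot0 (size E).+1). Qed.

Lemma size_kern E f : f \in kern E -> size f = size E.
Proof.
elim: E f => // r E IHE f /=; case: r => [|c r].
  by rewrite inE => /orP[/eqP -> | /mapP[g /IHE gE ->]] /=; rewrite ?size_nseq ?gE.
by move=> /mapP[g /IHE gE ->] /=; rewrite gE.
Qed.

Lemma kern_orth d E f : rowsP (fun v => size v = d) 0 E -> f \in kern E -> orth E f.
Proof.
move: 0%N => k; elim: E k f => // r E IHE k f /= [rP EP].
case: r rP => [_ | c r rP].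
  rewrite inE => /orP[/eqP -> | /mapP[g gE ->]]; split=> //=; first exact: orth0.
  exact: IHE EP gE.
have [//|/= -> _] := rP _; move=> /mapP[g gE ->] /=; split; last exact: IHE EP gE.
by rewrite addbb.
Qed.

Lemma orth_rowsP d E k w v : rowsP (fun u => size u = d) k E -> orth E v -> size w = k ->
  size v = size E -> rowsP (fun u => size u = d /\ dot u (w ++ v) = false) k E.
Proof.
elim: E k w v => // r E IHE k w [|b v] //= [rP EP] [rv Ev] wk [vE].
split.
  move=> r0; have [-> ->] := rP r0; split=> //; split=> //.
  by rewrite -wk dot_prefix rv.
by rewrite -cat_rcons; apply: IHE => //; rewrite size_rcons wk.
Qed.

Lemma vanishesP v : reflect (v = nseq (size v) false) (vanishes v).
Proof.
apply: (iffP idP) => [|->]; last by rewrite /vanishes all_nseq orbT.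
by elim: v => //= -[] //= v IHv /IHv {1}->.
Qed.

Lemma size_reduce E v : rowsP (fun u => size u = size E) 0 E -> size v = size E ->
  size (reduce E v) = size E.
Proof.
move=> EP vE; have [||+ _] := @reduceP (size E) (fun u => size u = size E) _ _ E [::] v vE EP => //.
  by move=> u w uE wE; rewrite size_xorv ?uE ?wE.
exact.
Qed.

Lemma size_insert E v : size (insert E v) = size E.
Proof.
elim: E v => //= r E IHE [|[] v] //=; last by rewrite IHE.
by case: r => [|c r] //=; rewrite IHE.
Qed.

Lemma size_echelon d vs : size (echelon d vs) = d.
Proof.
rewrite /echelon -[RHS](size_nseq d ([::] : seq bool)); move: (nseq d _) => E.
by elim: vs E => //= v vs IHvs E; rewrite IHvs size_insert.
Qed.

Lemma size_toggle p f : size (toggle p f) = size f.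
Proof. by elim: f p => [|b f IHf] [|p] //=; rewrite IHf. Qed.

Lemma dot_toggle p f x : size f = size x -> dot (toggle p f) x = dot f x (+) nth false x p.
Proof.
elim: f p x => [|b f IHf] p [|c x] //=; first by case: p.
move=> [fx]; case: p => [|p] /=; last by rewrite IHf // addbA.
by case: b; case: c; case: (dot f x).
Qed.

Lemma size_form ps : size (form ps) = 320%N.
Proof. by elim: ps => [|p ps IHps]; rewrite ?size_nseq //= size_toggle. Qed.

Lemma dot_form ps x : size x = 320%N -> dot (form ps) x = xors [seq nth false x p | p <- ps].
Proof.
move=> sx; elim: ps => [|p ps IHps]; first by rewrite dot0.
by rewrite /= dot_toggle ?IHps 1?addbC // size_form.
Qed.

Lemma xors_cat s s' : xors (s ++ s') = xors s (+) xors s'.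
Proof. by elim: s => //= a s ->; rewrite addbA. Qed.

Definition sat t (x : seq bool) :=
  forall ps, ps \in relations t -> xors [seq nth false x p | p <- ps] = false.

Lemma rowsP_size vs : (forall v, v \in vs -> size v = 320%N) ->
  rowsP (fun u => size u = 320%N) 0 (echelon 320 vs).
Proof.
by move=> vsP; apply: (@echelonP 320 (fun u => size u = 320%N)) => // u v su sv; rewrite size_xorv ?su ?sv.
Qed.

Lemma Rsys_size t : rowsP (fun u => size u = 320%N) 0 (Rsys t).
Proof. by apply: rowsP_size => _ /mapP[ps _ ->]; apply: size_form. Qed.

Lemma reduce_dot d E x f :
    rowsP (fun u => size u = d /\ dot u x = false) 0 E -> size E = d -> size f = d ->
  vanishes (reduce E f) -> dot f x = false.
Proof.
move=> EP sE sf /vanishesP f0.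
have EPs : rowsP (fun u => size u = d) 0 E.
  by elim: E (0%N) EP {sE f0} => //= r E IHE k [rP /IHE ?]; split=> // /rP[-> []].
have [_ []] // : size f = d /\ dot f x = false.
apply/(@reduceP d _ _ _ E [::] f sf EP) => [u v [su du] [sv dv]|u []//|] /=.
  by rewrite size_xorv ?dot_xorv ?su ?sv ?du ?dv.
by rewrite f0 size_nseq dot0 -sE size_reduce // sE.
Qed.

Lemma sat_form t x f : size x = 320%N -> sat t x -> size f = 320%N ->
  vanishes (reduce (Rsys t) f) -> dot f x = false.
Proof.
move=> sx xt; apply: reduce_dot; last exact: size_echelon.
apply: echelonP => [u v [su du] [sv dv]|_ /mapP[ps pst ->]].
  by rewrite size_xorv ?dot_xorv ?su ?sv ?du ?dv.
by split; rewrite ?size_form // dot_form // xt.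
Qed.

Lemma kern_sat t b : consistent t (Rsys t) -> b \in kern (Rsys t) -> sat t b.
Proof.
move=> /allP cR bK ps pst.
have sb : size b = 320%N by rewrite (size_kern bK) size_echelon.
have Rb := kern_orth (Rsys_size t) bK.
have RP := orth_rowsP (Rsys_size t) Rb (erefl (size [::])) (size_kern bK).
rewrite -dot_form //; apply: reduce_dot RP _ (size_form ps) (cR _ pst).
exact: size_echelon.
Qed.

Lemma span_sat t (P : seq bool -> Prop) L x :
    (forall u v, P u -> P v -> P (xorv u v)) -> (forall u, P u -> size u = 320%N) ->
    P (nseq 320 false) -> size L = 320%N -> rowsP P 0 L -> spanned (Rsys t) L ->
  size x = 320%N -> sat t x -> P x.
Proof.
move=> PD Ps P0 sL LP /allP sp sx xt.
apply: (@kern_span 320 P PD Ps P0 L 0 x) => //; first by rewrite sL.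
move=> f fL; apply: (sat_form sx xt); first by rewrite (size_kern fL).
exact: sp.
Qed.

(** * The finite model describes the annihilated functionals *)

Definition bits (U : {set 'I_4}) : seq bool := [seq i \in U | i <- enum 'I_4].
Definition exps (m : mon) : seq nat := [seq m i | i <- enum 'I_4].
Definition unbits (l : seq bool) : {set 'I_4} := [set i : 'I_4 | nth false l i].
Definition unexps (e : seq nat) : mon := [multinom nth 0%N e i | i < 4].

Lemma mem_words (T : eqType) n (s w : seq T) :
  (w \in words n s) = (size w == n) && all (mem s) w.
Proof.
elim: n w => [|n IHn] [|x w] //=.
  by apply/allpairsP => -[[y v] [_ _]].
rewrite eqSS andbCA -IHn; apply/allpairsP/andP => [[[y v] /= [ys vw [-> ->]]] // | [xs ww]].
by exists (x, w).
Qed.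

Lemma size_bits U : size (bits U) = 4. Proof. by rewrite size_map size_enum_ord. Qed.
Lemma size_exps m : size (exps m) = 4. Proof. by rewrite size_map size_enum_ord. Qed.

Lemma nth_bits U (i : 'I_4) : nth false (bits U) i = (i \in U).
Proof. by rewrite (nth_map i) ?size_enum_ord // nth_ord_enum. Qed.

Lemma nth_exps m (i : 'I_4) : nth 0%N (exps m) i = m i.
Proof. by rewrite (nth_map i) ?size_enum_ord // nth_ord_enum. Qed.

Lemma eq_seq4 (T : Type) (x0 : T) (s s' : seq T) : size s = 4 -> size s' = 4 ->
  (forall i : 'I_4, nth x0 s i = nth x0 s' i) -> s = s'.
Proof.
move=> s4 s4' ss; apply: (@eq_from_nth _ x0) => [|i]; first by rewrite s4.
by rewrite s4 => i4; apply: (ss (Ordinal i4)).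
Qed.

Lemma bits_subs U : bits U \in subs.
Proof.
by rewrite -[subs]/(words 4 [:: false; true]) mem_words size_bits; apply/allP => -[].
Qed.

Lemma unbitsK U : unbits (bits U) = U.
Proof. by apply/setP => i; rewrite inE nth_bits. Qed.

Lemma bitsK l : l \in subs -> bits (unbits l) = l.
Proof.
rewrite -[subs]/(words 4 [:: false; true]) mem_words => /andP[/eqP l4 _].
by apply: (@eq_seq4 _ false) => // [|i]; rewrite ?size_bits // nth_bits inE.
Qed.

Lemma count_bits U : count id (bits U) = #|U|.
Proof. by rewrite count_map -sum1_count big_enum_cond /= sum1_card; apply: eq_card. Qed.

Lemma unexpsK m : unexps (exps m) = m.
Proof. by apply/mnmP => i; rewrite mnmE nth_exps. Qed.

Lemma mdeg_exps m : sumn (exps m) = mdeg m.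
Proof. by rewrite sumnE big_map mdegE -big_enum. Qed.

Lemma mem_monos k m : (exps m \in monos k) = (mdeg m == k).
Proof.
rewrite mem_filter mdeg_exps mem_words size_exps eqxx andTb.
case: eqP => // mk; rewrite andTb; apply/allP => _ /mapP[i _ ->].
rewrite -[mem _ _]/(m i \in iota 0 k.+1) mem_iota add0n ltnS -mk mdegE.
by rewrite (bigD1 i) //= leq_addr.
Qed.

Lemma exps_cubics m : mdeg m = 3%N -> exps m \in cubics.
Proof. by move=> m3; rewrite -[cubics]/(monos 3) mem_monos m3. Qed.

Lemma expsK k e : e \in monos k -> exps (unexps e) = e.
Proof.
rewrite mem_filter mem_words => /and3P[_ /eqP e4 _].
by apply: (@eq_seq4 _ 0%N) => // [|i]; rewrite ?size_exps // nth_exps mnmE.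
Qed.

Lemma bits_setU1 (i : 'I_4) U : bits (i |: U) = addl i (bits U).
Proof.
apply: (@eq_seq4 _ false) => [||j]; rewrite ?size_set_nth ?size_bits ?(maxn_idPr _) //.
by rewrite nth_set_nth /= !nth_bits !inE -val_eqE /=; case: eqP.
Qed.

Lemma bits_setD1 (i : 'I_4) U : bits (U :\ i) = set_nth false (bits U) i false.
Proof.
apply: (@eq_seq4 _ false) => [||j]; rewrite ?size_set_nth ?size_bits ?(maxn_idPr _) //.
by rewrite nth_set_nth /= !nth_bits !inE -val_eqE /=; case: eqP.
Qed.

Lemma exps_addU (i : 'I_4) m : exps (U_(i) + m) = incr i (exps m).
Proof.
apply: (@eq_seq4 _ 0%N) => [||j]; rewrite ?size_set_nth ?size_exps ?(maxn_idPr _) //.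
rewrite nth_set_nth /= !nth_exps mnmDE mnm1E val_eqE eq_sym.
by have [->|] := eqVneq i j; rewrite ?add1n.
Qed.

Lemma exps0 : exps 0 = nseq 4 0%N.
Proof.
apply: (@eq_seq4 _ 0%N) => [||j]; rewrite ?size_exps ?size_nseq //.
by rewrite nth_exps mnm0E nth_nseq if_same.
Qed.

Definition Fx (x : seq bool) (U : {set 'I_4}) : fnl := fun m =>
  if mdeg m == 3%N then (nth false x (posn (bits U) (exps m)))%:R else 0.

Lemma homdeg_Fx x U : homdeg 3 (Fx x U).
Proof. by move=> m /eqP m3; rewrite /Fx (negbTE m3). Qed.

Lemma natF2_inj (b b' : bool) : b%:R = b'%:R :> 'F_2 -> b = b'.
Proof. by case: b; case: b' => // /(congr1 val). Qed.

Lemma natF2_addb (b b' : bool) : (b (+) b')%:R = b%:R + b'%:R :> 'F_2.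
Proof. by case: b; case: b'; apply/val_inj. Qed.

Lemma natF2_neq0 (c : 'F_2) : (c != 0)%:R = c.
Proof. by case: (F2_cases c) => ->. Qed.

Lemma xors_F2 s : (xors s)%:R = \sum_(b <- s) b%:R :> 'F_2.
Proof. by elim: s => [|b s IHs]; rewrite ?big_nil // big_cons -IHs -natF2_addb. Qed.

Lemma xors_nth1 x q : xors [seq nth false x p | p <- [:: q]] = nth false x q.
Proof. by rewrite /= addbF. Qed.

Lemma xors_nth2 x q q' :
  xors [seq nth false x p | p <- [:: q; q']] = nth false x q (+) nth false x q'.
Proof. by rewrite /= addbF. Qed.

Lemma relations_cases t ps : ps \in relations t ->
  [\/ exists U e, [/\ U \in subs, ~~ allowed t U, e \in cubics & ps = [:: posn U e]],
      exists U (i j : 'I_4), [/\ U \in subs, allowed t U &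
        ps = [:: posn U (incr i (incr i (incr j (nseq 4 0%N))));
                 posn U (incr j (incr i (incr j (nseq 4 0%N))))]]
    | exists U e, [/\ U \in subs, (count id U < t)%N, e \in monos 2 &
        ps = [seq posn (addl i U) (incr i e) | i <- iota 0 4]]].
Proof.
rewrite mem_cat => /orP[/allpairsP[[U e] []] | ].
  by rewrite mem_filter => /andP[Ua Us] eM ->; apply: Or31; exists U, e.
rewrite mem_cat => /orP[/allpairsP[[U ij] []] | /allpairsP[[U e] []]].
  rewrite mem_filter => /andP[Ua Us] /allpairsP[[i j] []].
  rewrite !mem_iota => /= i4 j4 -> ->; apply: Or32.
  by exists U, (Ordinal i4), (Ordinal j4).
by rewrite mem_filter => /andP[Ua Us] eM ->; apply: Or33; exists U, e.
Qed.

Lemma satP t x : sat t x <->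
  [/\ forall U m, ~~ allowed t (bits U) -> Fx x U m = 0,
      forall U i j, allowed t (bits U) ->
        Fx x U (U_(i) + (U_(i) + U_(j)))%MM = Fx x U (U_(j) + (U_(i) + U_(j)))%MM
    & forall (U : {set 'I_4}) m, (#|U| < t)%N -> contr (fun i => Fx x (i |: U)) m = 0].
Proof.
have mdeg3 (i j k : 'I_4) : mdeg (U_(i) + (U_(j) + U_(k))) = 3%N by rewrite !mdegD !mdeg1.
have FxE U m : mdeg m = 3%N -> Fx x U m = (nth false x (posn (bits U) (exps m)))%:R.
  by rewrite /Fx => ->.
have expsE (i j k : 'I_4) :
    exps (U_(i) + (U_(j) + U_(k))) = incr i (incr j (incr k (nseq 4 0%N))).
  by rewrite -exps0 -[U_(k)%MM]addm0 !exps_addU.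
have contrE U m : mdeg m = 2%N -> contr (fun i => Fx x (i |: U)) m =
    (xors [seq nth false x p | p <- [seq posn (addl i (bits U)) (incr i (exps m)) | i <- iota 0 4]])%:R.
  move=> m2; rewrite xors_F2 big_map big_map -[iota 0 4]/(index_iota 0 4) big_mkord.
  apply: eq_bigr => i _; rewrite FxE ?mdegD ?mdeg1 ?m2 //.
  by rewrite bits_setU1 exps_addU.
split=> [xt | [x1 x2 x3] ps].
  split=> [U m Ua | U i j Ua | U m Ut].
  - rewrite /Fx; case: eqP => // m3.
    suff /xt : [:: posn (bits U) (exps m)] \in relations t by rewrite xors_nth1 => ->.
    rewrite mem_cat; apply/orP; left; apply/allpairsP.
    by exists (bits U, exps m); rewrite mem_filter Ua bits_subs exps_cubics.
  - rewrite (FxE _ _ (mdeg3 i i j)) (FxE _ _ (mdeg3 j i j)) (expsE i i j) (expsE j i j).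
    set p := posn _ _; set q := posn _ _.
    suff /xt : [:: p; q] \in relations t.
      by rewrite xors_nth2 => /negbT; rewrite negb_add => /eqP ->.
    rewrite mem_cat; apply/orP; right; rewrite mem_cat; apply/orP; left; apply/allpairsP.
    exists (bits U, (val i, val j)); rewrite mem_filter Ua bits_subs; split=> //.
    by apply/allpairsP; exists (val i, val j); rewrite !mem_iota !ltn_ord.
  - have [m2 | m2] := eqVneq (mdeg m) 2%N; last first.
      by apply: (homdeg_contr (n := 3)) => [i|]; [apply: homdeg_Fx | apply/eqP].
    rewrite contrE // xt // mem_cat; apply/orP; right; rewrite mem_cat; apply/orP; right; apply/allpairsP.
    by exists (bits U, exps m); rewrite mem_filter count_bits Ut bits_subs mem_monos m2.
case/relations_cases=> [[U [e [Us Ua eM ->]]] | [U [i [j [Us Ua ->]]]] | [U [e [Us Ua eM ->]]]].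
- have := x1 (unbits U) (unexps e); rewrite (bitsK Us) => /(_ Ua).
  have e3 := expsK (k := 3) eM; have me : mdeg (unexps e) = 3%N.
    by apply/eqP; rewrite -mem_monos e3.
  by rewrite FxE // (bitsK Us) e3 xors_nth1 => /(@natF2_inj _ false).
- have := x2 (unbits U) i j; rewrite (bitsK Us) => /(_ Ua).
  rewrite (FxE _ _ (mdeg3 i i j)) (FxE _ _ (mdeg3 j i j)) (expsE i i j) (expsE j i j).
  by rewrite (bitsK Us) xors_nth2 => /natF2_inj ->; rewrite addbb.
- have e2 := expsK eM; have me : mdeg (unexps e) = 2%N by apply/eqP; rewrite -mem_monos e2.
  have := x3 (unbits U) (unexps e); rewrite -count_bits (bitsK Us) => /(_ Ua).
  by rewrite contrE // (bitsK Us) e2 => /(@natF2_inj _ false).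
Qed.

Lemma nth_allpairs (S T : eqType) (R : Type) (x0 : R) (g : S -> T -> R) s t a b :
  a \in s -> b \in t ->
  nth x0 (flatten [seq [seq g x y | y <- t] | x <- s]) (size t * index a s + index b t) = g a b.
Proof.
move=> + bt; elim: s => //= x s IHs; rewrite inE nth_cat size_map.
have [-> _ | xa /= ains] := eqVneq a x.
  by rewrite muln0 add0n index_mem bt (nth_map b) ?index_mem // nth_index.
rewrite mulnS -addnA ltnNge leq_addr /= addKn.
exact: IHs.
Qed.

Lemma nth_posn (g : seq bool -> seq nat -> bool) U e : U \in subs -> e \in cubics ->
  nth false (flatten [seq [seq g U e | e <- cubics] | U <- subs]) (posn U e) = g U e.
Proof. exact: (@nth_allpairs _ _ _ false g subs cubics). Qed.

Lemma size_flatten_blocks (g : seq bool -> seq nat -> bool) :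
  size (flatten [seq [seq g U e | e <- cubics] | U <- subs]) = 320%N.
Proof. by rewrite size_allpairs. Qed.

Definition vec t s (c : fnl) : seq bool :=
  flatten [seq [seq allowed t U && (coords s c (unbits U) (unexps e) != 0)
               | e <- cubics] | U <- subs].

Lemma size_vec t s c : size (vec t s c) = 320%N.
Proof. exact: size_flatten_blocks. Qed.

Lemma Fx_vec t s c U m : mdeg m = 3%N ->
  Fx (vec t s c) U m = if allowed t (bits U) then coords s c U m else 0.
Proof.
move=> m3; rewrite /Fx m3 eqxx.
rewrite (nth_posn _ (bits_subs U) (exps_cubics m3)) unbitsK unexpsK.
by case: ifP => _; rewrite /= ?natF2_neq0.
Qed.

Lemma eq_recon_supp k F G :
    (forall w, size w = k -> F [set i in w] =1 G [set i in w]) ->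
  recon k F =1 recon k G.
Proof.
elim: k F G => [|k IHk] F G FG.
  by have := FG [::] erefl; rewrite (_ : [set i in [::]] = set0) //; apply/setP => i; rewrite !inE.
apply: eq_join => i; apply: IHk => w wk m.
have e : [set j in i :: w] = i |: [set j in w] by apply/setP => j; rewrite !inE.
by rewrite -e; apply: FG; rewrite /= wk.
Qed.

Lemma slw_recon F w : slw w (recon (size w) F) =1 F [set i in w].
Proof.
elim: w F => [|i w IHw] F m /=.
  by rewrite (_ : [set i in [::]] = set0) //; apply/setP => i; rewrite !inE.
rewrite (eq_slw w (join_slice _ i)) IHw.
by rewrite (_ : [set j in i :: w] = i |: [set j in w]) //; apply/setP => j; rewrite !inE.
Qed.

(* The only annihilation conditions in degree three come from [Sq^1 (x_i x_j)]. *)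
Lemma prim3 c : homdeg 3 c ->
  prim c <-> forall i j, c (U_(i) + (U_(i) + U_(j)))%MM = c (U_(j) + (U_(i) + U_(j)))%MM.
Proof.
move=> c3.
have St2 i j : ev c (St 'X_[U_(i) + U_(j)]) =
    c (U_(i) + (U_(i) + U_(j)))%MM + c (U_(j) + (U_(i) + U_(j)))%MM.
  rewrite mpolyXD rmorphM /= !StXU mulrDr !mulrDl !expr2 -!mpolyXD !raddfD /= !evX.
  have -> : c (U_(i) + U_(j))%MM = 0 by apply: c3; rewrite mdegD !mdeg1.
  have -> : c (U_(i) + U_(i) + (U_(j) + U_(j)))%MM = 0 by apply: c3; rewrite !mdegD !mdeg1.
  rewrite add0r addr0 -addmA; congr (_ + c _).
  by apply/mnmP => k; rewrite !mnmDE addnCA.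
split=> [cP i j | cE].
  by apply: addF2_eq0; rewrite -St2 cP evX c3 // mdegD !mdeg1.
apply: primX => m; have [m3 | ] := leqP 3 (mdeg m); first exact: ev_St_low c3 m3.
case md : (mdeg m) => [|[|[|k]]] // _.
- move/eqP: md; rewrite mdeg_eq0 => /eqP ->.
  by rewrite mpolyX0 rmorph1 -mpolyX0 evX.
- have /mdeg1P[i /eqP ->] : mdeg m == 1%N by rewrite md.
  by rewrite StXU expr2 -mpolyXD raddfD /= !evX [c (_ + _)%MM]c3 ?addr0 ?mdegD ?mdeg1.
have [i mi] : exists i, m i != 0%N.
  apply/existsP; apply: contra_eqT md; rewrite negb_exists => /forallP m0.
  by rewrite mdegE big1 // => i _; have := m0 i; rewrite negbK => /eqP.
have mE : m = (U_(i) + (m - U_(i)))%MM.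
  apply/mnmP => j; rewrite mnmDE mnmBE mnm1E; case: eqP => [<-|_]; last by rewrite subn0.
  by rewrite subnKC // lt0n.
have /mdeg1P[j /eqP jE] : mdeg (m - U_(i)) == 1%N.
  by move: md; rewrite {1}mE mdegD mdeg1 add1n => -[->].
by rewrite mE jE St2 cE addF2K c3 // mdegD !mdeg1.
Qed.

Lemma nth_block x u j : (u < 16)%N -> (j < 20)%N ->
  nth false (nth [::] (reshape (nseq 16 20%N) x) u) j = nth false x (20 * u + j).
Proof.
move=> u16 j20; rewrite nth_reshape nth_nseq u16 nth_take // nth_drop.
rewrite (_ : take u (nseq 16 20%N) = nseq u 20%N) ?sumn_nseq //.
by rewrite take_nseq // ltnW.
Qed.

Definition mvm a b k (m : mon) : mon := (m - U_(a) *+ k + U_(b) *+ k)%MM.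

Lemma exps_mvm (a b : 'I_4) k m : a != b -> exps (mvm a b k m) = movem a b k (exps m).
Proof.
move=> ab; have szA : (a < 4)%N by []; have szB : (b < 4)%N by [].
apply: (@eq_seq4 _ 0%N) => [||j]; rewrite /movem ?size_set_nth ?size_exps ?(maxn_idPr _) //.
rewrite nth_set_nth /= nth_set_nth /= !nth_exps mnmDE mnmBE !mulmnE !mnm1E !val_eqE.
rewrite [j == b]eq_sym [j == a]eq_sym.
have [<-|bj] := eqVneq b j; first by rewrite (negbTE ab) mul0n subn0 mul1n.
by have [<-|aj] := eqVneq a j; rewrite ?mul1n mul0n addn0 ?subn0.
Qed.

Lemma mdeg_mvm a b k (m : mon) : (k <= m a)%N -> mdeg (mvm a b k m) = mdeg m.
Proof.
move=> km; have le : (U_(a) *+ k <= m)%MM.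
  by apply/mnm_lepP => i; rewrite mulmnE mnm1E; case: eqP => [<-|]; rewrite ?mul1n.
by rewrite mdegD mdegMn mdeg1 mul1n -{2}(submK le) mdegD mdegMn mdeg1 mul1n.
Qed.

Lemma tvX a b (m : mon) : a != b ->
  tv a b 'X_[m] = \sum_(k < (m a).+1) 'X_[mvm a b k m] *+ 'C(m a, k).
Proof.
move=> ab; pose r := (m - U_(a) *+ m a)%MM.
have mE : m = (U_(a) *+ m a + r)%MM.
  apply/mnmP => i; rewrite mnmDE mnmBE mulmnE mnm1E.
  by case: eqP => [<-|]; rewrite ?mul1n ?subnn ?addn0 ?mul0n ?subn0.
have tvr : tv a b 'X_[r] = 'X_[r].
  rewrite mpolyXE_id rmorph_prod; apply: eq_bigr => i _; rewrite rmorphXn /= tvXU.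
  by case: eqP => // ->; rewrite mnmBE mulmnE mnm1E eqxx mul1n subnn !expr0.
rewrite {1}mE mpolyXD rmorphM /= tvr -mpolyXn rmorphXn /= tvXU eqxx exprDn mulr_suml.
apply: eq_bigr => k _; rewrite mulrnAl; congr (_ *+ _).
rewrite !mpolyXn -!mpolyXD; congr 'X_[_]; apply/mnmP => i.
rewrite !mnmDE !mnmBE !mulmnE !mnm1E; have := ltn_ord k; rewrite ltnS => km.
by case: eqP => [<-|_]; case: eqP => [e|_]; rewrite ?mul1n ?mul0n; lia.
Qed.

Lemma nth_rowM (a b : 'I_4) x U m : a != b -> mdeg m = 3%N ->
  \sum_(j <- rowM a b (exps m)) (nth false x (20 * index (bits U) subs + j)%N)%:R
  = tvf a b (Fx x U) m.
Proof.
move=> ab m3; rewrite /tvf tvX // raddf_sum big_map big_filter big_mkcond nth_exps.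
rewrite -[iota 0 _]/(index_iota 0 (m a).+1) big_mkord; apply: eq_bigr => k _.
have km : (k <= m a)%N by rewrite -ltnS ltn_ord.
rewrite raddfMn /= evX /Fx (mdeg_mvm b km) m3 eqxx (exps_mvm k m ab).
rewrite -[posn _ _]/(20 * index (bits U) subs + index (movem a b k (exps m)) cubics)%N.
move: (nth false x _)%:R => c.
case: ifPn => oC; rewrite -[in RHS](odd_double_half 'C(m a, k)).
  by rewrite oC -mul2n mulrnDr mulrnA [c *+ 2]mulr2n addF2K mul0rn addr0.
by rewrite (negbTE oC) -mul2n mulrnDr mulrnA [c *+ 2]mulr2n addF2K mul0rn addr0.
Qed.

Lemma index_cubics m : mdeg m = 3%N -> (index (exps m) cubics < 20)%N.
Proof. by move=> /exps_cubics; rewrite -index_mem. Qed.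

Lemma index_subs U : (index (bits U) subs < 16)%N.
Proof. by have := bits_subs U; rewrite -index_mem. Qed.

Lemma rowM_lt (a b : 'I_4) m j : a != b -> mdeg m = 3%N -> j \in rowM a b (exps m) -> (j < 20)%N.
Proof.
move=> ab m3 /mapP[k]; rewrite mem_filter mem_iota nth_exps /= add0n ltnS => /andP[_ km] ->.
by rewrite -exps_mvm // index_cubics // mdeg_mvm.
Qed.

Section Level.
Variables (s : nat) (s_gt0 : (0 < s)%N).
Notation t := (minn s 5).

Lemma allowedE U : allowed t (bits U) = (0 < #|U| <= s)%N.
Proof.
rewrite /allowed count_bits leq_min; congr (_ && _).
by rewrite [(_ <= 5)%N]leqW ?card4 ?andbT.
Qed.

Lemma card_lt_t (U : {set 'I_4}) : (#|U| < t)%N = (#|U| < s)%N.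
Proof. by rewrite leq_min [(_ < 5)%N]card4 andbT. Qed.

Lemma card_support w : size w = s -> (0 < #|[set i : 'I_4 in w]| <= s)%N.
Proof.
move=> ws; rewrite cardsE; apply/andP; split; last by rewrite -ws card_size.
case: w ws s_gt0 => [<- //|i w _ _]; apply/card_gt0P; exists i.
exact: mem_head.
Qed.

Lemma coords_recon F (U : {set 'I_4}) : (0 < #|U| <= s)%N ->
  coords s (recon s F) U =1 F U.
Proof.
rewrite card_gt0 => /andP[U0 Us] m.
have := slw_recon F (cword s U) m; rewrite size_cword //.
by rewrite (_ : [set i in cword s U] = U) //; apply/setP => i; rewrite inE mem_cword.
Qed.

Lemma Mod0_coords c (U : {set 'I_4}) : Mod s c -> (0 < #|U| <= s)%N -> Mod 0 (coords s c U).
Proof. by move=> cM /andP[_ Us]; apply: Mod_coords. Qed.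

Lemma recon_vec c : Mod s c -> c =1 recon s (Fx (vec t s c)).
Proof.
move=> cM m; rewrite [LHS](recon_coords cM); apply: eq_recon_supp => {m} w ws m.
have Us := card_support ws.
have [m3 | /eqP m3] := eqVneq (mdeg m) 3%N; first by rewrite Fx_vec // allowedE Us.
by rewrite (homdeg_Fx _ _ m3); case: (Mod0_coords cM Us) => -> .
Qed.

Lemma sat_vec c : Mod s c -> sat t (vec t s c).
Proof.
move=> cM; apply/satP; split=> [U m Ua | U i j Ua | U m].
- have [m3 | /eqP m3] := eqVneq (mdeg m) 3%N; last exact: homdeg_Fx m3.
  by rewrite Fx_vec // (negbTE Ua).
- have m3 (k l : 'I_4) : mdeg (U_(k) + (U_(i) + U_(l))) = 3%N by rewrite !mdegD !mdeg1.
  rewrite !Fx_vec ?m3 // Ua; rewrite allowedE in Ua.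
  by have [UM /(prim3 UM) ->] := Mod0_coords cM Ua.
rewrite card_lt_t => Us; rewrite -[RHS](contr_coords cM Us m); apply: eq_bigr => i _.
have iUs : (0 < #|i |: U| <= s)%N.
  apply/andP; split; first by apply/card_gt0P; exists i; rewrite !inE eqxx.
  by rewrite cardsU1; case: (i \in U) => //=; apply: ltnW.
have [m3 | /eqP m3] := eqVneq (mdeg (U_(i) + m)) 3%N.
  by rewrite Fx_vec // allowedE iUs.
by rewrite (homdeg_Fx _ _ m3); case: (Mod0_coords cM iUs) => ->.
Qed.

Lemma Mod_Fx x : sat t x -> Mod s (recon s (Fx x)).
Proof.
case/satP=> [_ x2 x3]; apply: Mod_recon => [w ws | w ws m].
  split; first exact: homdeg_Fx.
  by apply/(prim3 (homdeg_Fx _ _)) => i j; apply: x2; rewrite allowedE card_support.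
by apply: x3; rewrite card_lt_t cardsE; apply: leq_ltn_trans ws; apply: card_size.
Qed.

Lemma rowU_bits (a b : 'I_4) U : rowU t a b (bits U) =
  if allowed t (bits U) then
    index (bits U) subs :: (if b \in U then [:: index (bits (a |: U :\ b)) subs] else [::])
  else [::].
Proof. by rewrite /rowU nth_bits bits_setU1 bits_setD1. Qed.

Lemma rowU_lt (a b : 'I_4) U u : u \in rowU t a b (bits U) -> (u < 16)%N.
Proof.
rewrite rowU_bits; case: ifP => // _; rewrite inE => /orP[/eqP ->|]; first exact: index_subs.
by case: ifP => // _; rewrite inE => /eqP ->; apply: index_subs.
Qed.

Lemma transvect_entry (a b : 'I_4) x U m : a != b -> mdeg m = 3%N ->
  xors [seq nth false (nth [::] (reshape (nseq 16 20%N) x) u) j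
       | u <- rowU t a b (bits U), j <- rowM a b (exps m)] =
  xors [seq nth false x p | p <- [seq (20 * u + j)%N
       | u <- rowU t a b (bits U), j <- rowM a b (exps m)]].
Proof.
move=> ab m3; congr xors; rewrite map_allpairs; apply/eq_in_allpairs => u j uU jm.
by rewrite nth_block // ?(rowU_lt uU) // (rowM_lt ab m3 jm).
Qed.

Lemma transvectE a b x : transvect t a b x =
  flatten [seq [seq xors [seq nth false (nth [::] (reshape (nseq 16 20%N) x) u) j
       | u <- rowU t a b U, j <- rowM a b e] | e <- cubics] | U <- subs].
Proof.
rewrite /transvect -map_comp; congr flatten; apply: eq_map => U /=.
Qed.

Lemma size_transvect a b x : size (transvect t a b x) = 320%N.
Proof. by rewrite transvectE size_flatten_blocks. Qed.

Lemma Fx_transvect (a b : 'I_4) x U m : a != b -> mdeg m = 3%N ->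
  Fx (transvect t a b x) U m = if allowed t (bits U) then tvF a b (Fx x) U m else 0.
Proof.
move=> ab m3; rewrite {1}/Fx m3 eqxx transvectE.
rewrite (nth_posn (fun U e => xors [seq nth false (nth [::] (reshape (nseq 16 20%N) x) u) j
  | u <- rowU t a b U, j <- rowM a b e]) (bits_subs U) (exps_cubics m3)).
rewrite transvect_entry // xors_F2 big_map big_allpairs_dep /= rowU_bits.
case: ifP => _; last by rewrite big_nil.
rewrite big_cons nth_rowM // /tvF; congr (_ + _).
by case: ifP => _; rewrite ?big_nil // big_seq1 nth_rowM.
Qed.
End Level.

Lemma Fx_xorv u v U m : Fx (xorv u v) U m = Fx u U m + Fx v U m.
Proof. by rewrite /Fx; case: ifP => _; rewrite ?addr0 // nth_xorv natF2_addb. Qed.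

Lemma homdeg_tvf a b n c : a != b -> homdeg n c -> homdeg n (tvf a b c).
Proof.
move=> ab cn m mn; rewrite /tvf tvX // raddf_sum big1 // => k _.
by rewrite raddfMn /= evX cn ?mul0rn // mdeg_mvm // -ltnS.
Qed.

Lemma homdeg_tvF a b n F : a != b -> (forall U, homdeg n (F U)) ->
  forall U, homdeg n (tvF a b F U).
Proof.
move=> ab Fn U m mn; rewrite /tvF (homdeg_tvf ab (Fn U) mn) add0r.
by case: ifP => // _; apply: (homdeg_tvf ab (Fn _) mn).
Qed.

Lemma homdeg_recon s F : (forall U, homdeg 3 (F U)) -> homdeg (nn s) (recon s F).
Proof.
elim: s F => [|s IHs] F Fn; first exact: Fn.
by apply: homdeg_join => i; apply: IHs.
Qed.

Lemma posn_surj p : (p < 320)%N ->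
  exists U e, [/\ U \in subs, e \in cubics & p = posn U e].
Proof.
move=> p320; have p16 : (p %/ 20 < size subs)%N by rewrite ltn_divLR.
have p20 : (p %% 20 < size cubics)%N by rewrite ltn_mod.
exists (nth [::] subs (p %/ 20)), (nth [::] cubics (p %% 20)).
by rewrite !mem_nth // /posn !index_uniq // mulnC -divn_eq.
Qed.

Lemma dot_zip (T : eqType) f (L : seq T) (h : T -> bool) (G : T -> seq nat) x :
    (forall p, p \in L -> h p = xors [seq nth false x q | q <- G p]) ->
  dot f [seq h p | p <- L] =
  xors [seq nth false x q | q <- flatten [seq (if c.1 then G c.2 else [::]) | c <- zip f L]].
Proof.
elim: f L => [|b f IHf] [|p L] //= hG.
rewrite map_cat xors_cat IHf => [|q qL]; last by apply: hG; rewrite inE qL orbT.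
by congr (_ (+) _); case: b => //=; apply: hG; rewrite mem_head.
Qed.

Section Model.
Variables (s : nat) (s_gt0 : (0 < s)%N).
Notation t := (minn s 5).
Notation n := (nn s).

Lemma dot_transvect (a b : 'I_4) f x : a != b -> size x = 320%N ->
  dot f (transvect t a b x) = dot (transpose t a b f) x.
Proof.
move=> ab x320; rewrite dot_form //.
pose h (p : seq nat * seq nat) :=
  xors [seq nth false (nth [::] (reshape (nseq 16 20%N) x) u) j | u <- p.1, j <- p.2].
pose G (p : seq nat * seq nat) := [seq (20 * u + j)%N | u <- p.1, j <- p.2].
apply: etrans (@dot_zip _ f [seq (us, js) | us <- [seq rowU t a b U | U <- subs],
  js <- [seq rowM a b e | e <- cubics]] h G x _); first by rewrite map_allpairs.
move=> _ /allpairsP[[us js] [/mapP[U Us usE] /mapP[e eM jsE] ->]].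
rewrite /h /G [(us, js).1]usE [(us, js).2]jsE.
rewrite -(bitsK Us) -(expsK (k := 3) eM) transvect_entry //.
by apply/eqP; rewrite -mem_monos (expsK (k := 3) eM).
Qed.

Lemma nth_vec c U e : U \in subs -> e \in cubics ->
  nth false (vec t s c) (posn U e) =
  allowed t U && (coords s c (unbits U) (unexps e) != 0).
Proof.
exact: (nth_posn (fun U e => allowed t U && (coords s c (unbits U) (unexps e) != 0))).
Qed.

Lemma vec_recon y : size y = 320%N -> (forall U m, ~~ allowed t (bits U) -> Fx y U m = 0) ->
  vec t s (recon s (Fx y)) = y.
Proof.
move=> y320 y0; apply: (@eq_from_nth _ false) => [|p]; rewrite size_vec // => p320.
have [U [e [Us eM ->]]] := posn_surj p320; rewrite nth_vec //.
have me : mdeg (unexps e) = 3%N by apply/eqP; rewrite -mem_monos (expsK (k := 3) eM).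
have yE : Fx y (unbits U) (unexps e) = (nth false y (posn U e))%:R.
  by rewrite /Fx me eqxx (bitsK Us) (expsK (k := 3) eM).
apply: natF2_inj; rewrite -yE; case: (boolP (allowed t U)) => Ua /=.
  rewrite natF2_neq0 coords_recon //.
  by rewrite -(allowedE s) bitsK.
by rewrite y0 // bitsK.
Qed.

Lemma eq_vec c d : c =1 d -> vec t s c = vec t s d.
Proof.
move=> cd; apply: (@eq_from_nth _ false) => [|p]; rewrite !size_vec // => p320.
have [U [e [Us eM ->]]] := posn_surj p320; rewrite !nth_vec //.
by rewrite /coords (eq_slw _ cd).
Qed.

Lemma slw_add w c d m : slw w (fun x => c x + d x) m = slw w c m + slw w d m.
Proof. by elim: w c d => //= i w IHw c d; apply: IHw. Qed.

Lemma vec_add c d : vec t s (fun m => c m + d m) = xorv (vec t s c) (vec t s d).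
Proof.
apply: (@eq_from_nth _ false) => [|p]; first by rewrite size_xorv !size_vec.
rewrite size_vec => p320; have [U [e [Us eM ->]]] := posn_surj p320.
rewrite nth_xorv !nth_vec //; case: (allowed t U) => //=; apply: natF2_inj.
by rewrite natF2_addb !natF2_neq0 /coords slw_add.
Qed.

Definition rho (x : seq bool) : Dual n := ofF n (recon s (Fx x)).

Lemma toF_rho x : toF (rho x) =1 recon s (Fx x).
Proof. by apply: toF_ofF; apply: homdeg_recon => U; apply: homdeg_Fx. Qed.

Lemma rho_xorv u v : rho (xorv u v) = rho u + rho v.
Proof.
apply: toF_inj => m; rewrite toFD !toF_rho recon_add.
by apply: eq_recon => U {}m; apply: Fx_xorv.
Qed.

Lemma primb_rho x : sat t x -> primb (rho x).
Proof.
move=> xt; apply/primbP; apply: eq_prim (proj2 (Mod_Fx s_gt0 xt)) => m.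
by rewrite toF_rho.
Qed.

Lemma Mod_toF (f : Dual n) : primb f -> Mod s (toF f).
Proof. by move=> /primbP fP; split=> //; apply: homdeg_toF. Qed.

Lemma rho_vec (f : Dual n) : primb f -> rho (vec t s (toF f)) = f.
Proof.
by move=> /Mod_toF fM; apply: toF_inj => m; rewrite toF_rho -recon_vec.
Qed.

Lemma toF_dact_rho (a b : 'I_4) x : a != b ->
  toF (dact (transv a b) (rho x)) =1 recon s (Fx (transvect t a b x)).
Proof.
move=> ab m; apply: etrans (toF_transv _ ab m) _.
apply: etrans (eq_ev (toF_rho x) _) _; apply: etrans (tvf_recon s (Fx x) ab m) _.
apply: eq_recon_supp => {m} w ws m.
have [m3 | /eqP m3] := eqVneq (mdeg m) 3%N.
  by rewrite Fx_transvect // allowedE card_support.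
exact: etrans (homdeg_tvF ab (homdeg_Fx x) [set i in w] m3) (esym (@homdeg_Fx _ _ m m3)).
Qed.

Lemma rho_transvect (a b : 'I_4) x : a != b ->
  rho (transvect t a b x) = dact (transv a b) (rho x).
Proof. by move=> ab; apply: toF_inj => m; rewrite toF_rho toF_dact_rho. Qed.

Lemma unitmx_transv (a b : 'I_4) : a != b -> transv a b \in unitmx.
Proof. by move=> ab; have [] := mulmx1_unit (transvK ab). Qed.

Lemma gens_coinv x : consistent t (Rsys t) -> x \in gens t (kern (Rsys t)) ->
  size x = 320%N /\ rho x \in coinv_rel n.
Proof.
move=> cR /flattenP[_ /mapP[[a b] ab ->] /mapP[y yK ->]].
have y320 : size y = 320%N by rewrite (size_kern yK) size_echelon.
have key (a' b' : 'I_4) : a' != b' ->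
    size (xorv (transvect t a' b' y) y) = 320%N /\
    rho (xorv (transvect t a' b' y) y) \in coinv_rel n.
  move=> ab'; rewrite size_xorv ?size_transvect ?y320 // rho_xorv (rho_transvect _ ab').
  split=> //; rewrite -[X in _ + X]oppDual coinv_rel_mem ?unitmx_transv //.
  exact/primb_rho/kern_sat.
pose o k (k4 : (k < 4)%N) : 'I_4 := Ordinal k4.
move: ab; rewrite !inE => /or4P[] /eqP[-> ->].
- exact: (key (o 0%N isT) (o 1%N isT) isT).
- exact: (key (o 1%N isT) (o 2%N isT) isT).
- exact: (key (o 2%N isT) (o 3%N isT) isT).
- exact: (key (o 3%N isT) (o 0%N isT) isT).
Qed.

Lemma spanned_sub (V : {vspace Dual n}) L :
    (coinv_rel n <= V)%VS -> size L = 320%N ->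
    rowsP (fun x => size x = 320%N /\ rho x \in V) 0 L -> spanned (Rsys t) L ->
  forall f, primb f -> f \in V.
Proof.
move=> CV sL LV sp f fP; rewrite -(rho_vec fP).
have PD u v : size u = 320%N /\ rho u \in V -> size v = 320%N /\ rho v \in V ->
    size (xorv u v) = 320%N /\ rho (xorv u v) \in V.
  by move=> [su uV] [sv vV]; rewrite size_xorv ?su ?sv // rho_xorv rpredD.
have [] // : size (vec t s (toF f)) = 320%N /\ rho (vec t s (toF f)) \in V.
apply: (@span_sat t _ L _ PD _ _ sL LV sp) => [u []//|||].
- split; first by rewrite size_nseq.
  have -> : nseq 320 false = xorv (nseq 320 false) (nseq 320 false) by [].
  rewrite rho_xorv -[X in _ + X]oppDual subrr; exact: mem0v.
- exact: size_vec.
exact/sat_vec/Mod_toF.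
Qed.

Lemma coinv_dim_check0 : check0 t -> coinv_dim n = 0%N.
Proof.
case/andP=> cR sp; apply: coinv_dim_eq0.
apply: (spanned_sub (subvv _) (size_echelon _ _) _ sp).
have PD u v : size u = 320%N /\ rho u \in coinv_rel n ->
    size v = 320%N /\ rho v \in coinv_rel n ->
    size (xorv u v) = 320%N /\ rho (xorv u v) \in coinv_rel n.
  by move=> [su uV] [sv vV]; rewrite size_xorv ?su ?sv // rho_xorv rpredD.
exact: (@echelonP 320 _ PD (gens t (kern (Rsys t))) (fun x => gens_coinv cR)).
Qed.

Lemma coinv_dim_check1 : check1 t -> coinv_dim n = 1%N.
Proof.
rewrite /check1; set psi := nth _ _ _; set x0 := nth _ _ _.
case/and5P=> cR psi1 /eqP s_psi x0K /andP[sp /allP inv].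
clearbody psi x0; have x0sat := kern_sat cR x0K.
have s0 : size x0 = 320%N by rewrite (size_kern x0K) size_echelon.
pose Psi (f : Dual n) : 'F_2 := (dot psi (vec t s (toF f)))%:R.
apply: (@coinv_dim_eq1 n (rho x0) Psi).
- move=> f f'; rewrite /Psi -natF2_addb (eq_vec (toFD f f')) vec_add.
  by rewrite dotC dot_xorv ?size_vec // ![dot _ psi]dotC.
- exact: primb_rho.
- rewrite /Psi (eq_vec (toF_rho x0)) vec_recon ?psi1 //.
  by case/satP: x0sat.
- move=> a b f ab fP; rewrite /Psi; congr (nat_of_bool _)%:R.
  have xsat := sat_vec (Mod_toF fP); set x := vec t s (toF f) in xsat *.
  have x320 : size x = 320%N by apply: size_vec.
  have -> : vec t s (toF (dact (transv a b) f)) = transvect t a b x.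
    rewrite -{1}(rho_vec fP) (eq_vec (toF_dact_rho x ab)) vec_recon ?size_transvect //.
    move=> U m Ua; have [m3 | /eqP m3] := eqVneq (mdeg m) 3%N.
      by rewrite Fx_transvect // (negbTE Ua).
    exact: homdeg_Fx m3.
  have ai : val a \in iota 0 4 by rewrite mem_iota ltn_ord.
  have bi : val b \in iota 0 4 by rewrite mem_iota ltn_ord.
  have := allP (inv _ ai) _ bi; cbv beta; rewrite val_eqE (negbTE ab) orFb.
  have sT : size (transpose t a b psi) = 320%N by apply: size_form.
  move=> /(sat_form x320 xsat); rewrite size_xorv ?sT ?s_psi // => /(_ erefl).
  rewrite dot_xorv ?sT ?s_psi // dot_transvect //.
  by case: (dot _ _); case: (dot _ _).
have VC : (coinv_rel n <= <[rho x0]> + coinv_rel n)%VS by apply: addvSr.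
apply: (spanned_sub VC _ _ sp); first by rewrite size_insert size_echelon.
have PD u v : size u = 320%N /\ rho u \in (<[rho x0]> + coinv_rel n)%VS ->
    size v = 320%N /\ rho v \in (<[rho x0]> + coinv_rel n)%VS ->
    size (xorv u v) = 320%N /\ rho (xorv u v) \in (<[rho x0]> + coinv_rel n)%VS.
  by move=> [su uV] [sv vV]; rewrite size_xorv ?su ?sv // rho_xorv rpredD.
refine (@insertP (fun x => size x = 320%N /\ rho x \in (<[rho x0]> + coinv_rel n)%VS) PD _ 0 _ _ _).
  apply: (@echelonP 320 _ PD) => x /(gens_coinv cR)[sx xC].
  by split; last exact: subvP VC _ xC.
by split=> //; apply: subvP (addvSl _ _) _ (memv_line _).
Qed.

End Model.

Lemma check1_1 : check1 1. Proof. by vm_cast_no_check (erefl true). Qed.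
Lemma check0_2 : check0 2. Proof. by vm_cast_no_check (erefl true). Qed.
Lemma check1_3 : check1 3. Proof. by vm_cast_no_check (erefl true). Qed.
Lemma check1_4 : check1 4. Proof. by vm_cast_no_check (erefl true). Qed.
Lemma check1_5 : check1 5. Proof. by vm_cast_no_check (erefl true). Qed.

Local Close Scope ring_scope.

Theorem theorem2p1p1 (s : nat) :
  (0 < s)%N ->
  coinv_dim (2 ^ (s + 2) + 2 ^ (s + 1) - 3) = (if s == 2 then 0 else 1)%N.
Proof.
rewrite -nnE; case: s => [|[|[|[|[|s]]]]] // _.
- exact: (@coinv_dim_check1 1 isT check1_1).
- exact: (@coinv_dim_check0 2 isT check0_2).
- exact: (@coinv_dim_check1 3 isT check1_3).
- exact: (@coinv_dim_check1 4 isT check1_4).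
apply: (@coinv_dim_check1 s.+4.+1 isT); rewrite (_ : minn _ 5 = 5%N) ?check1_5 //.
Qed.
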